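(* Let $t_0\in[0,1]$, let $\lambda(t_0)$ be an isolated eigenvalue of $\mathcal L_{t_0}$ of multiplicity $m\ge1$, and let the orthonormal basis $\{u_j\}_{j=1}^m$ of $\ker(\mathcal L_{t_0}-\lambda(t_0))$ and the labeling $\{\lambda_j(t)\}_{j=1}^m$ of the eigenvalues of $\mathcal L_t$ bifurcating from $\lambda(t_0)$, for $t$ near $t_0$, be such that $\dot\lambda_j(t_0)=-\langle\dot\Theta_{t_0}\gamma_Du_j,\gamma_Du_j\rangle_{L^2(\partial\Omega)}$, $1\le j\le m$. Denote $\mathbf q_j:=(\mathrm Tu_j,\mathrm Tu_j)$. Then $\mathbf q_j\in(\mathcal K_{\lambda(t_0)}\oplus\mathcal F_{t_0})\cap\mathfrak D$ and $$\dot\lambda_j(t_0)=\mathfrak m_{t_0}(\mathbf q_j,\mathbf q_j),\quad1\le j\le m,$$ where $\mathfrak m_{t_0}$ is the Maslov crossing form for the path $t\mapsto\mathcal K_{\lambda(t_0)}\oplus\mathcal F_t$ relative to $\mathfrak D$.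
   Context: $\Omega\subset\mathbb R^n$ is a bounded domain with $C^\infty$ boundary and outward unit normal $\nu$. $\mathcal L=-\sum_{j,k}\partial_ja_{jk}\partial_k+\sum_j(a_j\partial_j-\partial_ja_j)+q$, with $a_{jk}=a_{kj}$, $a_j\in C^\infty(\overline\Omega;\mathbb R)$, $q\in L^\infty(\Omega;\mathbb R)$, and $\sum_{j,k}a_{jk}(x)\xi_k\overline{\xi_j}\ge c\sum_j|\xi_j|^2$ for some $c>0$ and all $x\in\overline\Omega$, $\xi\in\mathbb C^n$. $\mathcal D^1(\Omega)=\{u\in H^1(\Omega):\mathcal Lu\in L^2(\Omega)\}$ with norm $(\|u\|_{H^1}^2+\|\mathcal Lu\|_{L^2}^2)^{1/2}$. $\gamma_D$ is the Dirichlet trace; $\gamma_{N,\mathcal L}\in\mathcal B(\mathcal D^1(\Omega),H^{-1/2}(\partial\Omega))$ is the unique extension of the co-normal derivative $\sum_{j,k}a_{jk}\nu_j\gamma_D(\partial_ku)+\sum_ja_j\nu_j\gamma_Du$, $u\in H^2(\Omega)$. $H^{-1/2}(\partial\Omega)$ is the dual of $H^{1/2}(\partial\Omega)$ with $\psi\in L^2(\partial\Omega)$ identified with $f\mapsto\langle f,\psi\rangle_{L^2(\partial\Omega)}$ (inner products linear in the first argument), and $\Phi:H^{-1/2}(\partial\Omega)\to H^{1/2}(\partial\Omega)$ is the Riesz isomorphism: $\langle f,\psi\rangle_{-1/2}=\langle f,\Phi\psi\rangle_{H^{1/2}(\partial\Omega)}$. $\mathrm T=[\Gamma_0,\Gamma_1]^\top:=[\gamma_D,-\Phi\gamma_{N,\mathcal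 L}]^\top:\mathcal D^1(\Omega)\to\mathfrak H\times\mathfrak H$, $\mathfrak H=H^{1/2}(\partial\Omega)$. $t\mapsto\Theta_t$ is in $C^1([0,1],L^\infty(\partial\Omega;\mathbb R))$, $\iota:H^{1/2}(\partial\Omega)\hookrightarrow L^2(\partial\Omega)$ is the embedding with adjoint $\iota^*:L^2(\partial\Omega)\hookrightarrow H^{-1/2}(\partial\Omega)$, and $\mathcal L_t$ is the self-adjoint operator $\mathcal L_tu=\mathcal Lu$ in $L^2(\Omega)$ with domain $\{u\in\mathcal D^1(\Omega):\gamma_{N,\mathcal L}u=\iota^*\Theta_t\iota\gamma_Du\}$. The eigenvalues bifurcating from $\lambda(t_0)$ are the $m$ eigenvalues (with multiplicity) of $\mathcal L_t$, $t$ near $t_0$, in a small disc around $\lambda(t_0)$ containing no other point of $\mathrm{Spec}(\mathcal L_{t_0})$. For $\lambda\in\mathbb R$, $\mathcal K_\lambda:=\mathrm T\big(\{u\in H^1(\Omega):\sum_{j,k}\langle a_{jk}\partial_ku,\partial_j\varphi\rangle_{L^2(\Omega)}+\sum_j\langle a_j\partial_ju,\varphi\rangle_{L^2(\Omega)}+\sum_j\langle u,a_j\partial_j\varphi\rangle_{L^2(\Omega)}+\langle qu-\lambda u,\varphi\rangle_{L^2(\Omega)}=0\ \forall\varphi\in H^1_0(\Omega)\}\big)$. $\mathcal F_t:=\{(f,-\Phi\iota^*\Theta_t\iota f):f\in\mathfrak H\}$. $\mathfrak D:=\{(p,p):p\in\mathfrak H\times\mathfrak H\}$. $J=\begin{bmatrix}0&I\\-I&0\end{bmatrix}$,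 $\omega(f,g)=\langle Jf,g\rangle_{\mathfrak H\times\mathfrak H}$, $\widehat\omega=\omega\oplus(-\omega)$. There are an interval $\mathcal I\subset[0,1]$ centered at $t_0$ and a $C^1$ family $t\mapsto\mathcal M_t\in\mathcal B(\mathcal F_{t_0},\mathcal F_{t_0}^\perp)$ with $\mathcal M_{t_0}=0$ and $\mathcal F_t=\{q+\mathcal M_tq:q\in\mathcal F_{t_0}\}$, $t\in\mathcal I$. The Maslov crossing form is $\mathfrak m_{t_0}(\mathbf q,\mathbf p):=\frac{d}{dt}\big|_{t=t_0}\widehat\omega(\mathbf q,\mathcal M_t\mathbf p)$ for $\mathbf p,\mathbf q\in(\mathcal K_{\lambda(t_0)}\oplus\mathcal F_{t_0})\cap\mathfrak D$, where $\mathcal M_t$ acts on the second ($\mathcal F_{t_0}$) component of $\mathbf p$ and by zero on the first ($\mathcal K_{\lambda(t_0)}$) component. *)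

(* Defs.v *)
From HB Require Import structures.
From mathcomp Require Import all_boot all_order all_algebra.
From mathcomp Require Import complex.
From mathcomp Require Import all_classical all_reals all_analysis.

Set Implicit Arguments.
Unset Strict Implicit.
Unset Printing Implicit Defensive.

Import Order.TTheory GRing.Theory Num.Theory.
Import numFieldNormedType.Exports.

Local Open Scope classical_set_scope.
Local Open Scope ring_scope.
Local Open Scope complex_scope.
Local Notation Re := complex.Re.
Local Notation Im := complex.Im.

(* - R^n is 'rV[R]_n, the complex numbers are R[i].                          *)
(* - An element of a function space (L^2, L^oo, H^1, H^1/2) is represented   *)
(*   by a function 'rV[R]_n -> R[i]; two representatives are identified when *)
(*   they agree almost everywhere (ae_same), for Lebesgue measure on Omega   *)
(*   or for surface measure on the boundary. The two measures are restricted *)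
(*   to Omega and to its boundary, so the values elsewhere are irrelevant.   *)
(* - Inner products are linear in the first argument.                        *)

(* An alias of T in which all sets are measurable: with it, the library's    *)
(* mu_ext tau is the outer measure generated by countable covers by          *)
(* arbitrary sets, a set A being charged tau A (possibly +oo).               *)
Definition all_sets (T : Type) : Type := T.

Section all_sets_measurable.
Variable T : pointedType.
HB.instance Definition _ := Pointed.copy (all_sets T) T.
HB.instance Definition _ := @isMeasurable.Build default_measure_display
  (all_sets T) setT I (fun _ _ => I) (fun _ _ => I).
End all_sets_measurable.

Section restricted_outer_measure.
Context (R : realType) (T : Type) (mu : {outer_measure set T -> \bar R}).
Variable D : set T.
Local Open Scope ereal_scope.

Definition outer_restr (A : set T) : \bar R := mu (A `&` D).

Let outer_restr0 : outer_restr set0 = 0.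
Proof. by rewrite /outer_restr set0I outer_measure0. Qed.

Let outer_restr_ge0 A : 0 <= outer_restr A.
Proof. exact: outer_measure_ge0. Qed.

Let outer_restr_le : {homo outer_restr : A B / A `<=` B >-> A <= B}.
Proof. by move=> A B AB; apply: le_outer_measure; exact: setSI. Qed.

Let outer_restr_sub : sigma_subadditive outer_restr.
Proof.
move=> F; rewrite /outer_restr setI_bigcupl.
exact: outer_measure_sigma_subadditive.
Qed.

HB.instance Definition _ := isOuterMeasure.Build R T outer_restr
  outer_restr0 outer_restr_ge0 outer_restr_le outer_restr_sub.

End restricted_outer_measure.

Section lebesgue_outer_measure.
Context (R : realType) (n : nat).
Local Notation X := 'rV[R]_n.
Local Open Scope ereal_scope.

Definition box (a b : X) : set X :=
  [set x | forall i, (a ord0 i <= x ord0 i <= b ord0 i)%R].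

Definition box_charge (A : set X) : \bar R :=
  ereal_inf [set v | (A = set0 /\ v = 0) \/
    exists a b : X, [/\ forall i, (a ord0 i <= b ord0 i)%R, A = box a b &
      v = (\prod_i (b ord0 i - a ord0 i))%R%:E]].

Definition leb_outer : set X -> \bar R :=
  mu_ext (box_charge : set (all_sets X) -> \bar R).

Let charge_ge0 A : 0 <= box_charge A.
Proof.
apply: le_ereal_inf_tmp => v [[_ ->//]|[a [b [ab _ ->]]]].
by rewrite lee_fin prodr_ge0// => i _; rewrite subr_ge0.
Qed.

Let charge0 : box_charge set0 = 0.
Proof.
by apply/eqP; rewrite eq_le charge_ge0 andbT; apply: ereal_inf_lbound; left.
Qed.

HB.instance Definition _ := isOuterMeasure.Build R X leb_outer
  (@mu_ext0 _ (all_sets X) R _ charge0 charge_ge0)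
  (@mu_ext_ge0 _ (all_sets X) R _ charge_ge0)
  (@le_mu_ext _ (all_sets X) R _)
  (@mu_ext_sigma_subadditive _ (all_sets X) R _ charge_ge0).

End lebesgue_outer_measure.

Section hausdorff_outer_measure.
Context (R : realType) (n : nat).
Local Notation X := 'rV[R]_n.

(* The library's norm on 'rV[R]_n is the sup norm; this is the Euclidean one.*)
Definition enorm (x : X) : R := Num.sqrt (\sum_i x ord0 i ^+ 2).

Definition diam (A : set X) : R :=
  sup [set r | exists x y, [/\ A x, A y & r = enorm (x - y)]].

(* volume of the Euclidean unit ball of R^s:                                 *)
(* alpha_0 = 1, alpha_1 = 2, alpha_(s+2) = 2 pi / (s+2) * alpha_s            *)
Fixpoint ball_volume (s : nat) : R :=
  match s with
  | 0 => 1
  | 1 => 2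
  | (s'.+2 as s0) => 2 * pi / s0%:R * ball_volume s'
  end.

Local Open Scope ereal_scope.

Definition diam_charge (s : nat) (d : R) (A : set X) : \bar R :=
  ereal_inf [set v | (A = set0 /\ v = 0) \/
    ((forall x y, A x -> A y -> (enorm (x - y) <= d)%R) /\
     v = (ball_volume s * (diam A / 2) ^+ s)%R%:E)].

(* s-dimensional Hausdorff measure, normalized so that it is s-dimensional   *)
(* area on smooth surfaces (counting measure for s = 0)                      *)
Definition hausdorff_outer (s : nat) (A : set X) : \bar R :=
  ereal_sup [set mu_ext (diam_charge s d : set (all_sets X) -> \bar R) A
            | d in [set d : R | (0 < d)%R]].

Lemma diam_ge0 (A : set X) : (0 <= diam A)%R.
Proof.
rewrite /diam; set S := (X in sup X).
have [supS|/sup_out ->//] := pselect (has_sup S).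
have [r Sr] := supS.1; apply: le_trans (ub_le_sup supS.2 Sr).
by case: Sr => x [y [_ _ ->]]; exact: sqrtr_ge0.
Qed.

Lemma ball_volume_ge0 s : (0 <= ball_volume s)%R.
Proof.
suff : (0 <= ball_volume s)%R /\ (0 <= ball_volume s.+1)%R by case.
elim: s => [|s [h1 h2]]; first by rewrite /= ler01 ler0n.
by split=> //; rewrite mulr_ge0// divr_ge0// mulr_ge0// pi_ge0.
Qed.

Let charge_ge0 s d A : 0 <= diam_charge s d A.
Proof.
apply: le_ereal_inf_tmp => v [[_ ->//]|[_ ->]].
by rewrite lee_fin mulr_ge0 ?ball_volume_ge0// exprn_ge0// divr_ge0// diam_ge0.
Qed.

Let charge0 s d : diam_charge s d set0 = 0.
Proof.
by apply/eqP; rewrite eq_le charge_ge0 andbT; apply: ereal_inf_lbound; left.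
Qed.

Let H_ge0 s A : 0 <= hausdorff_outer s A.
Proof.
apply: le_trans (ereal_sup_ubound _); last by exists 1%R => //=; exact: ltr01.
exact: (@mu_ext_ge0 _ (all_sets X) R _ (charge_ge0 s 1)).
Qed.

Let H0 s : hausdorff_outer s set0 = 0.
Proof.
apply/eqP; rewrite eq_le H_ge0 andbT; apply: ge_ereal_sup => _ [d _ <-].
by rewrite (@mu_ext0 _ (all_sets X) R _ (charge0 s d) (charge_ge0 s d)).
Qed.

Let H_le s : {homo hausdorff_outer s : A B / A `<=` B >-> A <= B}.
Proof.
move=> A B AB; apply: ge_ereal_sup => _ [d d0 <-].
apply: le_trans (ereal_sup_ubound _); last by exists d.
exact: (@le_mu_ext _ (all_sets X) R _ A B AB).
Qed.

Let H_sub s : sigma_subadditive (hausdorff_outer s).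
Proof.
move=> F; apply: ge_ereal_sup => _ [d d0 <-].
apply: le_trans (@mu_ext_sigma_subadditive _ (all_sets X) R _
  (charge_ge0 s d) F) _.
apply: lee_nneseries => [i _ _|i _].
  exact: (@mu_ext_ge0 _ (all_sets X) R _ (charge_ge0 s d)).
by apply: ereal_sup_ubound; exists d.
Qed.

HB.instance Definition _ s := isOuterMeasure.Build R X (hausdorff_outer s)
  (H0 s) (H_ge0 s) (@H_le s) (@H_sub s).

End hausdorff_outer_measure.

Definition sqmod (R : realType) (z : R[i]) : R := Re z ^+ 2 + Im z ^+ 2.
Definition cmod (R : realType) (z : R[i]) : R := Num.sqrt (sqmod z).

Section lebesgue_spaces.
Context d (T : measurableType d) (R : realType).
Variable mu : {measure set T -> \bar R}.
Implicit Types f g : T -> R[i].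

Definition ae_same f g : Prop := {ae mu, forall x, f x = g x}.

Definition cintegral f : R[i] :=
  Rintegral mu setT (fun x => Re (f x)) +i* Rintegral mu setT (fun x => Im (f x)).

Definition L2 : set (T -> R[i]) :=
  [set f | [/\ measurable_fun [set: T] (fun x => Re (f x)),
               measurable_fun [set: T] (fun x => Im (f x)) &
               (\int[mu]_x (sqmod (f x))%:E < +oo)%E]].

Definition L2_ip f g : R[i] := cintegral (fun x => f x * (g x)^*).

Definition L2_norm f : R := Num.sqrt (Rintegral mu setT (fun x => sqmod (f x))).

Definition L2_cvg (f_ : nat -> T -> R[i]) f : Prop :=
  [/\ forall k, L2 (f_ k), L2 f &
      L2_norm (fun x => f_ k x - f x) @[k --> \oo] --> 0].

Definition Linfty : set (T -> R) :=
  [set f | measurable_fun [set: T] f /\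
           (Lnorm mu +oo (EFin \o f) < +oo)%E].

(* th is in C^1(I, L^oo) with derivative dth; limits are taken within I, so  *)
(* derivatives are one-sided at the end points of I                          *)
Definition C1_Linfty (I : set R) (th dth : R -> T -> R) : Prop :=
  forall t, I t ->
    [/\ Linfty (th t), Linfty (dth t),
        (Lnorm mu +oo (fun x => ((th s x - th t x) / (s - t) - dth t x)%:E)
          @[s --> within I t^'] --> 0)%E &
        (Lnorm mu +oo (fun x => (dth s x - dth t x)%:E)
          @[s --> within I (nbhs t)] --> 0)%E].

Variables (dom : set (T -> R[i])) (A : (T -> R[i]) -> (T -> R[i])).

Definition resolvent_set : set R[i] :=
  [set z | (forall f, L2 f -> exists2 u, dom u &
               ae_same (fun x => A u x - z * u x) f) /\
           (exists c : R, forall u, dom u ->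
               L2_norm u <= c * L2_norm (fun x => A u x - z * u x))].

Definition spectrum : set R[i] := ~` resolvent_set.

Definition eigenfunctions (z : R[i]) : set (T -> R[i]) :=
  [set u | dom u /\ ae_same (A u) (fun x => z * u x)].

Definition orthonormal_basis_of (m : nat) (E : set (T -> R[i]))
    (u : 'I_m -> T -> R[i]) : Prop :=
  [/\ forall j, E (u j),
      forall j k, L2_ip (u j) (u k) = (j == k)%:R &
      forall v, E v -> exists c : 'I_m -> R[i],
        ae_same v (fun x => \sum_j c j * u j x)].

(* z0 is isolated in the spectrum by the closed disc of radius e *)
Definition isolating_radius (z0 : R[i]) (e : R) : Prop :=
  0 < e /\ forall z, spectrum z -> cmod (z - z0) <= e -> z = z0.

End lebesgue_spaces.

(* the eigenvalues of the family A_t that lie near lam0 for t near t0,       *)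
(* repeated according to multiplicity, are lam 0 t, ..., lam (m-1) t         *)
Definition bifurcating_eigenvalues d (T : measurableType d) (R : realType)
    (mu : {measure set T -> \bar R})
    (dom : R -> set (T -> R[i])) (A : (T -> R[i]) -> (T -> R[i]))
    (I : set R) (t0 lam0 : R) (m : nat) (lam : 'I_m -> R -> R) : Prop :=
  exists2 e, isolating_radius mu (dom t0) A lam0%:C e &
  \forall t \near t0, I t ->
    [/\ forall j, `|lam j t - lam0| < e,
        forall z, cmod (z - lam0%:C) < e ->
          (spectrum mu (dom t) A z <-> exists j, z = (lam j t)%:C) &
        forall j, exists v : 'I_#|[set k | lam k t == lam j t]%SET| -> T -> R[i],
          orthonormal_basis_of mu (eigenfunctions mu (dom t) A (lam j t)%:C) v].

Section smooth.
Context (R : realType) (n : nat).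
Local Notation X := 'rV[R]_n.

Definition pd (i : 'I_n) (f : X -> R) : X -> R :=
  'D_(delta_mx ord0 i : X) f.

Definition pdC (i : 'I_n) (f : X -> R[i]) : X -> R[i] :=
  fun x => pd i (fun y => Re (f y)) x +i* pd i (fun y => Im (f y)) x.

Definition smooth_on (U : set X) (f : X -> R) : Prop :=
  forall (s : seq 'I_n) x, U x ->
    let g := foldr pd f s in
    {for x, continuous g} /\
    forall i, derivable g x (delta_mx ord0 i : X).

Definition smooth_onC (U : set X) (f : X -> R[i]) : Prop :=
  smooth_on U (fun x => Re (f x)) /\ smooth_on U (fun x => Im (f x)).

(* C^oo(closure of Om): restrictions of smooth functions on R^n *)
Definition smooth_closure (Om : set X) (f : X -> R) : Prop :=
  exists2 g, smooth_on setT g & forall x, closure Om x -> f x = g x.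

Definition smooth_closureC (Om : set X) (f : X -> R[i]) : Prop :=
  exists2 g, smooth_onC setT g & forall x, closure Om x -> f x = g x.

Definition bd (Om : set X) : set X := closure Om `\` Om°.

Definition grad (f : X -> R) (x : X) : X := \row_i pd i f x.

Definition defining_function (Om : set X) (x : X) (U : set X) (rho : X -> R) :
    Prop :=
  [/\ open U, U x, smooth_on U rho, grad rho x != 0 &
      forall y, U y -> (Om y <-> rho y < 0)].

Definition smooth_bounded_domain (Om : set X) : Prop :=
  [/\ open Om, Om !=set0, connected Om, bounded_set Om &
      forall x, bd Om x -> exists U rho, defining_function Om x U rho].

Definition outward_normal (Om : set X) (x : X) : X :=
  xget 0 [set v | exists U rho, defining_function Om x U rho /\
                    v = (enorm (grad rho x))^-1 *: grad rho x].

Definition test_function (Om : set X) : set (X -> R[i]) :=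
  [set phi | smooth_onC setT phi /\
     exists K : set X,
       [/\ compact K, K `<=` Om & forall x, ~ K x -> phi x = 0]].

End smooth.

Section domain_measures.
Context (R : realType) (n : nat).
Local Notation X := 'rV[R]_n.
Variable Om : set X.

Definition vol_outer : {outer_measure set X -> \bar R} :=
  outer_restr (@leb_outer R n) Om.

Definition surf_outer : {outer_measure set X -> \bar R} :=
  outer_restr (@hausdorff_outer R n n.-1) (bd Om).

(* Lebesgue measure on Om and surface measure on the boundary of Om, on      *)
(* their Caratheodory sigma-algebras                                         *)
Definition vol : {measure set (caratheodory_type vol_outer) -> \bar R} :=
  (vol_outer : set (caratheodory_type vol_outer) -> \bar R).

Definition surf : {measure set (caratheodory_type surf_outer) -> \bar R} :=
  (surf_outer : set (caratheodory_type surf_outer) -> \bar R).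

End domain_measures.

Section sobolev.
Context (R : realType) (n : nat).
Local Notation X := 'rV[R]_n.
Local Notation fn := (X -> R[i]).
Variable Om : set X.
Local Notation volO := (vol Om).
Local Notation surfO := (surf Om).
Implicit Types u v g phi : fn.

Definition weak_pd (i : 'I_n) u g : Prop :=
  forall phi, test_function Om phi ->
    cintegral volO (fun x => u x * pdC i phi x) =
    - cintegral volO (fun x => g x * phi x).

Definition H1 : set fn :=
  [set u | L2 volO u /\ forall i, exists2 g, L2 volO g & weak_pd i u g].

(* the weak partial derivative (meaningful for u in H1) *)
Definition wpd (i : 'I_n) u : fn :=
  xget (fun=> 0) [set g | L2 volO g /\ weak_pd i u g].

Definition H1_norm u : R :=
  Num.sqrt (L2_norm volO u ^+ 2 + \sum_i L2_norm volO (wpd i u) ^+ 2).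

Definition H10 : set fn :=
  [set phi | H1 phi /\
     exists2 phi_ : nat -> fn, forall k, test_function Om (phi_ k) &
       L2_cvg volO phi_ phi /\
       forall i, L2_cvg volO (fun k => pdC i (phi_ k)) (wpd i phi)].

Definition H2 : set fn := [set u | H1 u /\ forall i, H1 (wpd i u)].

(* H^1/2 of the boundary, with the Sobolev-Slobodeckij norm; the boundary    *)
(* has dimension n - 1, hence the exponent (n - 1) + 2 * 1/2 = n             *)
Definition slobodeckij g : \bar R :=
  (\int[surfO]_x \int[surfO]_y
     (sqmod (g x - g y) / enorm ((x : X) - (y : X)) ^+ n)%:E)%E.

Definition H12 : set fn :=
  [set g | L2 surfO g /\ (slobodeckij g < +oo)%E].

Definition H12_norm g : R :=
  Num.sqrt (L2_norm surfO g ^+ 2 + fine (slobodeckij g)).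

(* A Hilbert space inner product for the usual topology of H^1/2.            *)
Definition H12_inner_product (ip : fn -> fn -> R[i]) : Prop :=
  [/\ forall f f' g g', H12 f -> H12 f' -> H12 g -> H12 g' ->
        ae_same surfO f f' -> ae_same surfO g g' -> ip f g = ip f' g',
      forall z f f' g, H12 f -> H12 f' -> H12 g ->
        ip (fun x => z * f x + f' x) g = z * ip f g + ip f' g,
      forall f g, H12 f -> H12 g -> ip g f = (ip f g)^*,
      forall f, H12 f -> 0 <= ip f f &
      exists c1 c2 : R, [/\ 0 < c1, 0 < c2 & forall f, H12 f ->
        c1 * H12_norm f ^+ 2 <= Re (ip f f) <= c2 * H12_norm f ^+ 2]].

(* An element psi of H^-1/2 is represented by f |-> <f, psi>_-1/2, which is  *)
(* linear in f. Since <.,.>_-1/2 extends the L^2 inner product, it is        *)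
(* antilinear in psi: the scalar z acts on psi as multiplication of this     *)
(* functional by the conjugate of z.                                         *)
Definition Hm12 : set (fn -> R[i]) :=
  [set psi |
    [/\ forall f f', H12 f -> H12 f' -> ae_same surfO f f' -> psi f = psi f',
        forall z f f', H12 f -> H12 f' ->
          psi (fun x => z * f x + f' x) = z * psi f + psi f' &
        exists c : R, forall f, H12 f -> cmod (psi f) <= c * H12_norm f]].

Definition Hm12_same (psi psi' : fn -> R[i]) : Prop :=
  forall f, H12 f -> psi f = psi' f.

(* iota^* : L^2(bd Om) -> H^-1/2, the adjoint of the embedding iota, which   *)
(* is the identity on representatives                                        *)
Definition iota_star g : fn -> R[i] := fun f => L2_ip surfO f g.

Definition riesz_isomorphism (ip : fn -> fn -> R[i])
    (Phi : (fn -> R[i]) -> fn) : Prop :=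
  forall psi, Hm12 psi ->
    H12 (Phi psi) /\ forall f, H12 f -> psi f = ip f (Phi psi).

(* gD is the bounded operator H1 -> H^1/2 extending u |-> u|_bd *)
Definition dirichlet_trace (gD : fn -> fn) : Prop :=
  [/\ forall u, H1 u -> H12 (gD u),
      forall z u v, H1 u -> H1 v ->
        ae_same surfO (gD (fun x => z * u x + v x))
                      (fun x => z * gD u x + gD v x),
      exists c : R, forall u, H1 u -> H12_norm (gD u) <= c * H1_norm u &
      forall u, smooth_closureC Om u -> ae_same surfO (gD u) u].

End sobolev.

Section elliptic_operator.
Context (R : realType) (n : nat).
Local Notation X := 'rV[R]_n.
Local Notation fn := (X -> R[i]).
Variable Om : set X.
Local Notation volO := (vol Om).
Local Notation surfO := (surf Om).
Variables (a : 'I_n -> 'I_n -> X -> R) (b : 'I_n -> X -> R) (q : X -> R).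
Implicit Types u v f phi : fn.

Definition elliptic_coefficients : Prop :=
  [/\ forall j k x, closure Om x -> a j k x = a k j x,
      forall j k, smooth_closure Om (a j k),
      forall j, smooth_closure Om (b j),
      Linfty volO q &
      exists2 c : R, 0 < c & forall x (xi : 'I_n -> R[i]), closure Om x ->
        c%:C * \sum_j (sqmod (xi j))%:C <=
        \sum_j \sum_k (a j k x)%:C * xi k * (xi j)^*].

(* The sesquilinear form of calL - lam; dphi is the gradient of phi.         *)
Definition calL_form (lam : R) u phi (dphi : 'I_n -> fn) : R[i] :=
  \sum_j \sum_k L2_ip volO (fun x => (a j k x)%:C * wpd Om k u x) (dphi j)
  + \sum_j L2_ip volO (fun x => (b j x)%:C * wpd Om j u x) phi
  + \sum_j L2_ip volO u (fun x => (b j x)%:C * dphi j x)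
  + L2_ip volO (fun x => (q x)%:C * u x - lam%:C * u x) phi.

(* calL u = f in the sense of distributions, with f in L^2 *)
Definition calL_eq u f : Prop :=
  L2 volO f /\ forall phi, test_function Om phi ->
    calL_form 0 u phi (fun j => pdC j phi) = L2_ip volO f phi.

Definition D1 : set fn := [set u | H1 Om u /\ exists f, calL_eq u f].

Definition calL u : fn := xget (fun=> 0) [set f | calL_eq u f].

Definition D1_norm u : R :=
  Num.sqrt (H1_norm Om u ^+ 2 + L2_norm volO (calL u) ^+ 2).

Definition weak_solutions (lam : R) : set fn :=
  [set u | H1 Om u /\ forall phi, H10 Om phi ->
     calL_form lam u phi (fun j => wpd Om j phi) = 0].

(* gN is the bounded operator D1 -> H^-1/2 extending the co-normal           *)
(* derivative on H2                                                          *)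
Definition conormal_derivative (gD : fn -> fn) (gN : fn -> fn -> R[i]) : Prop :=
  [/\ forall u, D1 u -> Hm12 Om (gN u),
      forall z u v, D1 u -> D1 v ->
        Hm12_same Om (gN (fun x => z * u x + v x))
                     (fun f => z^* * gN u f + gN v f),
      exists c : R, forall u f, D1 u -> H12 Om f ->
        cmod (gN u f) <= c * D1_norm u * H12_norm Om f &
      forall u, H2 Om u ->
        Hm12_same Om (gN u) (iota_star Om (fun x =>
          \sum_j \sum_k (a j k x * outward_normal Om x ord0 j)%:C
                          * gD (wpd Om k u) x
          + \sum_j (b j x * outward_normal Om x ord0 j)%:C * gD u x))].

Variables (gD : fn -> fn) (gN : fn -> fn -> R[i]) (Theta : R -> X -> R).

Definition robin_domain (t : R) : set fn :=
  [set u | D1 u /\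
     Hm12_same Om (gN u) (iota_star Om (fun x => (Theta t x)%:C * gD u x))].

End elliptic_operator.

Section maslov.
Context (R : realType) (n : nat).
Local Notation X := 'rV[R]_n.
Local Notation fn := (X -> R[i]).
Variable Om : set X.
Local Notation surfO := (surf Om).
Variables (ip : fn -> fn -> R[i]) (Phi : (fn -> R[i]) -> fn).
Implicit Types p q : fn * fn.

Definition HH : set (fn * fn) := [set p | H12 Om p.1 /\ H12 Om p.2].

Definition HH_same p q : Prop :=
  ae_same surfO p.1 q.1 /\ ae_same surfO p.2 q.2.

Definition HH_scale (z : R[i]) p : fn * fn :=
  (fun x => z * p.1 x, fun x => z * p.2 x).

Definition HH_ip p q : R[i] := ip p.1 q.1 + ip p.2 q.2.
Definition HH_norm p : R := Num.sqrt (Re (HH_ip p p)).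

Definition orth_compl (E : set (fn * fn)) : set (fn * fn) :=
  [set p | HH p /\ forall q, E q -> HH_ip p q = 0].

Definition J p : fn * fn := (p.2, - p.1).
Definition omega p q : R[i] := HH_ip (J p) q.
Definition omega_hat (p q : (fn * fn) * (fn * fn)) : R[i] :=
  omega p.1 q.1 - omega p.2 q.2.

Definition calF (Theta : R -> X -> R) (t : R) : set (fn * fn) :=
  [set p | exists2 f, H12 Om f &
     HH_same p (f, - Phi (iota_star Om (fun x => (Theta t x)%:C * f x)))].

Definition traceT (gD : fn -> fn) (gN : fn -> fn -> R[i]) (u : fn) : fn * fn :=
  (gD u, - Phi (gN u)).

Definition calK (a : 'I_n -> 'I_n -> X -> R) (b : 'I_n -> X -> R) (q : X -> R)
    (gD : fn -> fn) (gN : fn -> fn -> R[i]) (lam : R) : set (fn * fn) :=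
  [set p | exists2 u, weak_solutions Om a b q lam u &
     HH_same p (traceT gD gN u)].

Definition osum (K F : set (fn * fn)) : set ((fn * fn) * (fn * fn)) :=
  [set p | K p.1 /\ F p.2].

Definition diagonal_HH : set ((fn * fn) * (fn * fn)) :=
  [set p | [/\ HH p.1, HH p.2 & HH_same p.1 p.2]].

Definition bounded_operator (E E' : set (fn * fn)) (A : fn * fn -> fn * fn) :
    Prop :=
  [/\ forall p, E p -> E' (A p),
      forall z p q, E p -> E q ->
        HH_same (A (HH_scale z p + q)) (HH_scale z (A p) + A q) &
      exists c : R, forall p, E p -> HH_norm (A p) <= c * HH_norm p].

Definition op_norm (E : set (fn * fn)) (A : fn * fn -> fn * fn) : \bar R :=
  ereal_sup [set (HH_norm (A p))%:E | p in [set p | E p /\ HH_norm p <= 1]].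

Definition C1_operators (I : set R) (E E' : set (fn * fn))
    (M dM : R -> fn * fn -> fn * fn) : Prop :=
  forall t, I t ->
    [/\ bounded_operator E E' (M t), bounded_operator E E' (dM t),
        op_norm E (fun p => HH_scale ((s - t)^-1)%:C (M s p - M t p) - dM t p)
          @[s --> within I t^'] --> 0%E &
        op_norm E (fun p => dM s p - dM t p)
          @[s --> within I (nbhs t)] --> 0%E].

Definition deriv_within (I : set R) (h : R -> R) (t0 : R) : R :=
  lim ((h t - h t0) / (t - t0) @[t --> within I t0^']).

Definition cderiv_within (I : set R) (h : R -> R[i]) (t0 : R) : R[i] :=
  deriv_within I (fun t => Re (h t)) t0 +i* deriv_within I (fun t => Im (h t)) t0.

(* M_t acts by zero on the first component *)
Definition maslov_form (I : set R) (t0 : R) (M : R -> fn * fn -> fn * fn)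
    (p q : (fn * fn) * (fn * fn)) : R[i] :=
  cderiv_within I (fun t => omega_hat p (0, M t q.2)) t0.

End maslov.

(* Main.v *)
Require Import Defs.
From HB Require Import structures.
From mathcomp Require Import all_boot all_order all_algebra.
From mathcomp Require Import complex.
From mathcomp Require Import all_classical all_reals all_analysis.
From mathcomp Require Import measurable_realfun ess_sup_inf.
From mathcomp Require Import ring lra.

Set Implicit Arguments.
Unset Strict Implicit.
Unset Printing Implicit Defensive.

Import Order.TTheory GRing.Theory Num.Theory.
Import numFieldNormedType.Exports.

Local Open Scope classical_set_scope.
Local Open Scope ring_scope.
Local Open Scope complex_scope.
Local Notation Re := complex.Re.
Local Notation Im := complex.Im.

(* Write f = gD u_j and p = T u_j. Green's formula for two points p, p + m   *)
(* of the subspaces F_t0, F_t collapses: the symplectic pairing only sees    *)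
(* the difference of the Robin multipliers, so that                          *)
(*   omega_hat q_j (0, M_t p) = - <f, (Theta_t - Theta_t0) (f + m_t)>,       *)
(* where m_t is the first component of M_t p. Since M is C^1 with            *)
(* M_t0 = 0, m_t -> 0 in L^2 of the boundary, and the difference quotient    *)
(* tends to - <f, dTheta_t0 f>, the given derivative of the eigenvalue.      *)
(* Behind this lies the measurability of Borel functions for the two         *)
(* Caratheodory measures and the fact that H^1/2 is a vector space; the      *)
(* latter needs Tonelli's theorem, hence sigma-finiteness of the surface     *)
(* measure, which is extracted from a nonzero element of H^1/2.              *)

(** * Caratheodory measurability *)

(** Fix an eigenfunction u and put f = [gD u], p = [traceT Phi gD gN u]. The Robin condition places
    p in [calF] at [t0]. The eigenvalue equation, which [calL_eq] states against test functions
    only, extends to H^1_0 by density and continuity of the form, so p lies in [calK]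
    ([eigenfunction_weak_solution]). Hence (p, p) lies in the intersection with the diagonal.

    For the derivative, p + M_t p lies in F_t, so its second component is the Riesz representative
    of minus the functional attached to Theta_t times its first component f + m_t. Both Robin
    conditions turn H^1/2 products into boundary L^2 products. Since Theta is real the remaining
    terms cancel, and omega_hat(q, (0, M_t p)) = - <f, (Theta_t - Theta_t0)(f + m_t)>
    ([omega_robin]). This vanishes at [t0]. Dividing by t - t0, the multiplier quotient tends to its
    derivative in L^oo and m_t tends to 0 in L^2 ([graph_map_small]). The error is bounded in
    [multiplier_quotient], and the limit is - <dTheta f, f>, which is the assumed formula for the
    eigenvalue derivative.

    The rest is measure theory. Measurability refers to Caratheodory sigma-algebras, so coordinates
    are first shown measurable by a separation criterion ([separated_caratheodory]). The Riesz
    arguments need H^1/2 to be a vector space ([H12_lin]). Its proof splits on sigma-finiteness of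
    the surface measure, which any nonzero element of H^1/2 forces ([H12_sigma_finite]). *)

Section outer_measures.
Local Open Scope ereal_scope.

(** Each cover F of Z gives the covers [s1 \o F] and [s2 \o F] of the two pieces, at no greater
    total charge. For Lebesgue measure [s1] and [s2] cut a box; for Hausdorff measure they keep or
    discard a whole set. *)
Lemma mu_ext_split (R : realType) (T : pointedType) (c : set T -> \bar R)
    (s1 s2 : set T -> set T) (X Y Z : set T) :
  (forall A, 0 <= c A) ->
  (forall A, A `&` X `<=` s1 A) -> (forall A, A `&` Y `<=` s2 A) ->
  (forall A, c (s1 A) + c (s2 A) <= c A) ->
  mu_ext (c : set (all_sets T) -> _) (Z `&` X) +
  mu_ext (c : set (all_sets T) -> _) (Z `&` Y) <=
  mu_ext (c : set (all_sets T) -> _) Z.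
Proof.
move=> c0 s1P s2P s12; apply: le_ereal_inf_tmp => _ [F [_ ZF] <-].
apply: (@le_trans _ _ (\sum_(k <oo) (c (s1 (F k)) + c (s2 (F k))))); last first.
  by apply: lee_nneseries => [i _ _|i _]; [exact: adde_ge0|exact: s12].
rewrite nneseriesD//; apply: leeD; apply: ereal_inf_lbound.
- exists (s1 \o F) => //; split => // z [/ZF[k _ Fz] Xz].
  by exists k => //; exact: s1P.
- exists (s2 \o F) => //; split => // z [/ZF[k _ Fz] Xz].
  by exists k => //; exact: s2P.
Qed.

(* Caratheodory's criterion for metric outer measures, for the sublevel sets *)
(* of one function. With B_k = {f >= c + 1/(k+1)} and the shells             *)
(* S_k = B_k.+1 \ B_k, separation gives mu S_k.+1 <= mu B_k.+2 - mu B_k, so  *)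
(* that the shells telescope.                                                *)
Lemma separated_caratheodory (R : realType) (T : Type)
    (mu : {outer_measure set T -> \bar R}) (f : T -> R) (c : R) :
  (forall (x y : R) Z, (x < y)%R ->
     mu (Z `&` [set t | (f t <= x)%R]) + mu (Z `&` [set t | (y <= f t)%R])
     <= mu Z) ->
  mu.-caratheodory [set t | (f t <= c)%R].
Proof.
move=> sep; apply: le_caratheodory_measurable => Z.
have [/eqP ->|Zoo] := boolP (mu Z == +oo); first exact: leey.
have muZ A : A `<=` Z -> mu A \is a fin_num.
  move=> AZ; rewrite ge0_fin_numE ?outer_measure_ge0//.
  by apply: le_lt_trans (le_outer_measure mu _ _ AZ) _; rewrite ltey.
set H := [set t | (f t <= c)%R].
pose d (k : nat) : R := (c + k.+1%:R^-1)%R.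
have dlt k l : (k < l)%N -> (d l < d k)%R.
  by move=> kl; rewrite ltrD2l ltf_pV2 ?posrE ?ltr0n// ltr_nat.
have cd k : (c < d k)%R by rewrite ltrDl invr_gt0 ltr0n.
pose B k := Z `&` [set t | (d k <= f t)%R].
pose S k := B k.+1 `&` [set t | (f t < d k)%R].
pose a k : R := fine (mu (B k)).
have BZ k : B k `<=` Z by move=> t [].
have SZ k : S k `<=` Z by move=> t [/BZ].
have aE k : mu (B k) = (a k)%:E by rewrite fineK// muZ.
have HB k : mu (Z `&` H) + mu (B k) <= mu Z by exact: sep.
have tel k : mu (S k.+1) <= (a k.+2 - a k)%:E.
  rewrite EFinB leeBrDr// -!aE.
  apply: le_trans (sep (d k.+1) (d k) (B k.+2) (dlt _ _ (ltnSn k))).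
  apply: leeD; apply: le_outer_measure.
    by move=> t [Bt /ltW St]; split.
  by move=> t [Zt dt]; split => //; split => //=; apply/(le_trans _ dt)/ltW/dlt.
have a_nd k l : (k <= l)%N -> (a k <= a l)%R.
  move=> kl; rewrite -lee_fin -!aE; apply: le_outer_measure.
  move=> t [Zt dt]; split => //=; apply: le_trans dt.
  by move: kl; rewrite leq_eqVlt => /predU1P[->//|/dlt/ltW].
have a_ub : has_sup (range a).
  split; first by exists (a 0%N), 0%N.
  exists (fine (mu Z)) => _ [k _ <-]; apply: fine_le; rewrite ?muZ//.
  exact: le_outer_measure.
set L := sup (range a).
have aL k : (a k <= L)%R by apply: (ub_le_sup a_ub.2); exists k.
have BL : mu (Z `&` ~` H) <= L%:E.
  apply/lee_addgt0Pr => e e0.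
  have [_ [K _ <-] aK] := sup_adherent (divr_gt0 e0 (@ltr0n R 2)) a_ub.
  rewrite -/L in aK.
  (* A point with f > c outside B_(K+1) has a least m with d_m <= f, and m > K+1; minimality puts it
     in the shell of index m - 1. *)
  have sub : Z `&` ~` H `<=` B K.+1 `|` \bigcup_k S (K.+1 + k)%N.
    move=> t [Zt /negP]; rewrite -ltNge => cf.
    have [dt|dt] := leP (d K.+1) (f t); first by left.
    right; have exm : exists m, (d m <= f t)%R.
      by have [m /ltW dm] := ltr_add_invr cf; exists m.
    case: (ex_minnP exm) => m dm mmin.
    have Km : (K.+1 < m)%N.
      rewrite ltnNge; apply/negP => mK; move: dt; rewrite ltNge => /negP; apply.
      apply: le_trans dm; move: mK.
      by rewrite leq_eqVlt => /predU1P[->//|/dlt/ltW].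
    have m0 : (0 < m)%N by exact: leq_trans Km.
    exists (m.-1 - K.+1)%N; first by [].
    have -> : (K.+1 + (m.-1 - K.+1) = m.-1)%N by rewrite subnKC// -ltnS prednK.
    split; first by rewrite prednK.
    by rewrite /= ltNge; apply/negP => /mmin; rewrite leqNgt ltn_predL m0.
  apply: le_trans (le_outer_measure mu _ _ sub) _.
  apply: le_trans (outer_measureU2 _ _ _) _.
  (* The sum telescopes with step two, leaving two boundary terms, each at most L - a_K by
     monotonicity; hence the factor 2, and the earlier choice of K with L - a_K < e / 2. *)
  apply: (@le_trans _ _ ((a K.+1)%:E + (2 * (L - a K))%:E)).
    rewrite aE leeD2l//.
    apply: le_trans (outer_measure_sigma_subadditive _ _) _.
    apply: lime_le.
      by apply: is_cvg_nneseries => *; exact: outer_measure_ge0.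
    apply: nearW => N.
    apply: (@le_trans _ _ (\sum_(0 <= i < N)
        (a (K + i).+2 - a (K + i)%N)%:E)).
      by apply: lee_sum => i _; rewrite addSn; exact: tel.
    rewrite sumEFin lee_fin.
    rewrite (_ : \sum_(_ <= i < _) _ =
        a (K + N).+1 + a (K + N)%N - a K.+1 - a K)%R.
      have := aL (K + N).+1; have := aL (K + N)%N.
      have := a_nd K K.+1 (leqnSn _).
      lra.
    elim: N => [|N IH].
      rewrite big_nil addn0; ring.
    by rewrite big_nat_recr//= IH !addnS; ring.
  by rewrite -!EFinD lee_fin; have := aL K.+1; lra.
rewrite -(fineK (muZ (Z `&` H) _)); last by move=> t [].
apply: (@le_trans _ _ ((fine (mu (Z `&` H)))%:E + L%:E)); first exact: leeD2l.
rewrite -(fineK (muZ Z _))// -EFinD lee_fin -lerBrDl.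
apply: ge_sup; first exact: a_ub.1.
move=> _ [k _ <-]; rewrite lerBrDl -lee_fin EFinD -aE !fineK ?muZ//.
Qed.

End outer_measures.

(** * Coordinates are measurable for Lebesgue and Hausdorff measure *)

Section coordinate_measurability.
Context (R : realType) (n : nat).
Local Notation X := 'rV[R]_n.
Local Open Scope ereal_scope.

Lemma box_charge_ge0 (A : set X) : 0 <= box_charge A.
Proof.
apply: le_ereal_inf_tmp => v [[_ ->//]|[a [b [ab _ ->]]]].
by rewrite lee_fin prodr_ge0// => i _; rewrite subr_ge0.
Qed.

Lemma box_charge0 : box_charge (set0 : set X) = 0.
Proof.
by apply/eqP; rewrite eq_le box_charge_ge0 andbT; apply: ereal_inf_lbound; left.
Qed.

Lemma box_charge_le (a b : X) : (forall i, (a ord0 i <= b ord0 i)%R) ->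
  box_charge (box a b) <= (\prod_i (b ord0 i - a ord0 i))%R%:E.
Proof. by move=> ab; apply: ereal_inf_lbound; right; exists a, b. Qed.

(** The hyperplane t_i = c cuts a box into two boxes with a common face, and the volume is additive
    in the i-th side length. A nonempty set that is not a box has charge +oo, as the infimum of the
    empty set. *)
Lemma box_charge_split (i : 'I_n) (c : R) (A : set X) :
  box_charge (A `&` [set t | (t ord0 i <= c)%R]) +
  box_charge (A `&` [set t | (c <= t ord0 i)%R]) <= box_charge A.
Proof.
apply: le_ereal_inf_tmp => v [[-> ->]|[a [b [ab -> ->]]]].
  by rewrite !set0I box_charge0 adde0.
have [ca|ac] := ltP c (a ord0 i).
  rewrite (_ : _ `&` _ = set0); last first.
    apply/seteqP; split=> // t [/(_ i)/andP[at_ _]] /= tc.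
    by move: ca at_ tc; lra.
  rewrite box_charge0 add0e (_ : _ `&` _ = box a b); first exact: box_charge_le.
  apply/seteqP; split=> [t []//|t tab]; split => //=.
  by have /andP[+ _] := tab i; move: ca; lra.
have [bc|cb] := ltP (b ord0 i) c.
  rewrite [X in _ + box_charge X](_ : _ `&` _ = set0); last first.
    apply/seteqP; split=> // t [/(_ i)/andP[_ tb]] /= ct.
    by move: bc tb ct; lra.
  rewrite box_charge0 adde0 (_ : _ `&` _ = box a b); first exact: box_charge_le.
  apply/seteqP; split=> [t []//|t tab]; split => //=.
  by have /andP[_ +] := tab i; move: bc; lra.
(* Here a_i <= c <= b_i; [b'] and [a'] are the corners with i-th coordinate moved to c. *)
pose b' : X := (\row_j if j == i then c else b ord0 j)%R.
pose a' : X := (\row_j if j == i then c else a ord0 j)%R.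
have -> : box a b `&` [set t | (t ord0 i <= c)%R] = box a b'.
  apply/seteqP; split => t.
    move=> [tab tc] j; rewrite mxE; have /andP[ta tb] := tab j.
    by rewrite ta/=; case: eqP => // ->.
  move=> tab; split.
    move=> j; have := tab j; rewrite mxE; case: eqP => // -> /andP[-> tc]/=.
    exact: le_trans tc cb.
  by have := tab i; rewrite mxE eqxx => /andP[].
have -> : box a b `&` [set t | (c <= t ord0 i)%R] = box a' b.
  apply/seteqP; split => t.
    move=> [tab tc] j; rewrite mxE; have /andP[ta tb] := tab j.
    by rewrite tb andbT; case: eqP => // ->.
  move=> tab; split.
    move=> j; have := tab j; rewrite mxE; case: eqP => // -> /andP[tc ->].
    by rewrite (le_trans ac tc).
  by have := tab i; rewrite mxE eqxx => /andP[].
apply: (le_trans (leeD (@box_charge_le a b' _) (@box_charge_le a' b _))).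
- by move=> j; rewrite mxE; case: eqP => // ->.
- by move=> j; rewrite mxE; case: eqP => // ->.
rewrite -EFinD lee_fin (bigD1 i)//= [X in (_ + X <= _)%R](bigD1 i)//=.
rewrite [X in (_ <= X)%R](bigD1 i)//= !mxE eqxx.
under eq_bigr => j /negbTE ji do rewrite mxE ji.
under [X in (_ + _ * X <= _)%R]eq_bigr => j /negbTE ji do rewrite mxE ji.
by rewrite -mulrDl ler_wpM2r// ?prodr_ge0//; [move=> j _; rewrite subr_ge0|lra].
Qed.

Lemma leb_outer_coord (i : 'I_n) (c : R) :
  (@leb_outer R n).-caratheodory [set t | (t ord0 i <= c)%R].
Proof.
apply: (@separated_caratheodory _ _ _ (fun t : X => t ord0 i)) => x y Z xy.
apply: le_trans (leeD2l _ _) (@mu_ext_split _ X _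
  (fun A => A `&` [set t | (t ord0 i <= x)%R])
  (fun A => A `&` [set t | (x <= t ord0 i)%R])
  [set t | (t ord0 i <= x)%R] [set t | (x <= t ord0 i)%R] _ _ _ _ _) => //.
- apply: (@le_outer_measure _ _ (@leb_outer R n)) => t [Zt /= yt]; split => //=.
  exact: le_trans (ltW xy) yt.
- exact: box_charge_ge0.
- by move=> A t.
- by move=> A t.
- exact: box_charge_split.
Qed.

Lemma coord_le_enorm (x : X) (i : 'I_n) : (`|x ord0 i| <= enorm x)%R.
Proof.
rewrite -sqrtr_sqr ler_wsqrtr// (bigD1 i)//= lerDl sumr_ge0// => j _.
exact: sqr_ge0.
Qed.

Lemma diam_charge_ge0 s (d : R) (A : set X) : 0 <= diam_charge s d A.
Proof.
apply: le_ereal_inf_tmp => v [[_ ->//]|[_ ->]].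
by rewrite lee_fin mulr_ge0 ?ball_volume_ge0// exprn_ge0// divr_ge0// diam_ge0.
Qed.

Lemma diam_charge0 s (d : R) : diam_charge s d (set0 : set X) = 0.
Proof.
apply/eqP; rewrite eq_le diam_charge_ge0 andbT.
by apply: ereal_inf_lbound; left.
Qed.

Lemma diam_charge_anti s (d e : R) (A : set X) : (d <= e)%R ->
  diam_charge s e A <= diam_charge s d A.
Proof.
move=> de; apply: ereal_inf_le_tmp => v [|[Ad ->]]; first by left.
by right; split => // x y Ax Ay; exact: le_trans (Ad _ _ Ax Ay) de.
Qed.

(** A set of diameter at most d < y - x cannot meet both half-spaces, so it is kept for the one it
    meets and replaced by the empty set for the other. A set meeting both has charge +oo. *)
Lemma diam_charge_split s (i : 'I_n) (d x y : R) (Z : set X) :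
  (d < y - x)%R ->
  mu_ext (diam_charge s d : set (all_sets X) -> _)
    (Z `&` [set t : X | (t ord0 i <= x)%R]) +
  mu_ext (diam_charge s d : set (all_sets X) -> _)
    (Z `&` [set t : X | (y <= t ord0 i)%R]) <=
  mu_ext (diam_charge s d : set (all_sets X) -> _) Z.
Proof.
move=> dxy.
pose meet (H A : set X) := if `[< A `&` H !=set0 >] then A else set0.
apply: (@mu_ext_split _ X _ (meet [set t : X | (t ord0 i <= x)%R])
  (meet [set t : X | (y <= t ord0 i)%R])).
- exact: diam_charge_ge0.
- by move=> A t [At xt]; rewrite /meet asboolT//; exists t.
- by move=> A t [At xt]; rewrite /meet asboolT//; exists t.
- move=> A; rewrite /meet; case: asboolP => [[t [At /= tx]]|_]; last first.
    rewrite diam_charge0 add0e; case: asboolP => // _.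
    by rewrite diam_charge0 diam_charge_ge0.
  case: asboolP => [[u [Au /= yu]]|_]; last by rewrite diam_charge0 adde0.
  rewrite [leRHS](_ : _ = +oo) ?leey//.
  apply/eqP; rewrite -leye_eq; apply: le_ereal_inf_tmp => v.
  case=> [[A0 _]|[Ad _]]; first by exfalso; rewrite A0 in At.
  have ut := Ad _ _ Au At.
  have := coord_le_enorm (u - t)%R i; rewrite !mxE => ti.
  have uti := ler_norm (u ord0 i - t ord0 i)%R.
  by exfalso; move: ut ti uti dxy tx yu; clear; lra.
Qed.

(** A smaller scale admits fewer covering sets, so the Hausdorff premeasure grows as the scale
    shrinks. *)
Lemma mu_ext_anti s (d e : R) (A : set X) : (d <= e)%R ->
  mu_ext (diam_charge s e : set (all_sets X) -> _) A <=
  mu_ext (diam_charge s d : set (all_sets X) -> _) A.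
Proof.
move=> de; apply: le_ereal_inf_tmp => _ [F [mF AF] <-].
apply: (@le_trans _ _ (\sum_(k <oo) diam_charge s e (F k))).
  by apply: ereal_inf_lbound; exists F.
apply: lee_nneseries => [k _ _|k _]; first exact: diam_charge_ge0.
exact: diam_charge_anti.
Qed.

Lemma hausdorff_outer_coord s (i : 'I_n) (c : R) :
  (@hausdorff_outer R n s).-caratheodory [set t | (t ord0 i <= c)%R].
Proof.
apply: (@separated_caratheodory _ _ _ (fun t : X => t ord0 i)) => x y Z xy.
have [Zoo|Zoo] := eqVneq (@hausdorff_outer R n s Z) +oo.
  by rewrite [leRHS](_ : _ = +oo) ?leey.
have hZ A : A `<=` Z -> @hausdorff_outer R n s A \is a fin_num.
  move=> AZ; rewrite ge0_fin_numE ?outer_measure_ge0//.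
  apply: le_lt_trans (le_outer_measure (@hausdorff_outer R n s) _ _ AZ) _.
  by rewrite ltey.
rewrite -leeBrDr; last by apply: hZ => t [].
apply: ge_ereal_sup => _ [d d0 <-].
have df : mu_ext (diam_charge s d : set (all_sets X) -> _)
    (Z `&` [set t : X | (t ord0 i <= x)%R]) \is a fin_num.
  rewrite ge0_fin_numE; last first.
    exact: (@mu_ext_ge0 _ (all_sets X) R _ (diam_charge_ge0 s d)).
  apply: (@le_lt_trans _ _ (@hausdorff_outer R n s Z)); last by rewrite ltey.
  apply: le_trans (le_outer_measure (@hausdorff_outer R n s)
    (Z `&` [set t : X | (t ord0 i <= x)%R]) Z (@subIsetl _ _ _)).
   by apply: ereal_sup_ubound; exists d.
rewrite leeBrDr; last by apply: hZ => t [].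
rewrite addeC -leeBrDr//; apply: ge_ereal_sup => _ [e e0 <-].
rewrite leeBrDr// addeC.
(* The two suprema are taken at independent scales d and e. Passing to a common scale only increases
   both terms, and a scale below the gap y - x allows splitting. *)
pose m := Num.min (Num.min d e) ((y - x) / 2)%R.
have m0 : (0 < m)%R by rewrite !lt_min d0 e0 divr_gt0// subr_gt0.
have mxy : (m < y - x)%R.
  by apply: (@le_lt_trans _ _ ((y - x) / 2)%R); [rewrite ge_min lexx orbT|lra].
apply: le_trans (leeD (mu_ext_anti _ _ (_ : m <= d)%R)
                      (mu_ext_anti _ _ (_ : m <= e)%R)) _.
- by rewrite !ge_min lexx.
- by rewrite !ge_min lexx orbT.
- apply: le_trans (diam_charge_split s i Z mxy) _.
  by apply: ereal_sup_ubound; exists m.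
Qed.

Lemma outer_restr_caratheodory (mu : {outer_measure set X -> \bar R})
    (D A : set X) :
  mu.-caratheodory A -> (outer_restr mu D).-caratheodory A.
Proof.
by move=> mA Z; rewrite /outer_restr (mA (Z `&` D)) ![_ `&` D `&` _]setIAC.
Qed.

Lemma caratheodory_measurable_fun (T : pointedType)
    (mu : {outer_measure set T -> \bar R}) (f : T -> R) :
  (forall c, mu.-caratheodory [set t | (f t <= c)%R]) ->
  measurable_fun [set: caratheodory_type mu] f.
Proof.
move=> muf.
apply: (measurability _ (RGenOInfty.measurableE R)).
move=> _ [_ [c ->] <-]; rewrite setTI.
rewrite [X in measurable X](_ : _ = ~` [set t : T | (f t <= c)%R]).
  by apply: measurableC; exact: muf.
apply/seteqP; split => t /=; rewrite in_itv/= andbT ltNge; first by move/negP.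
by move/negP.
Qed.

Lemma vol_coord_measurable (Om : set X) (i : 'I_n) :
  measurable_fun [set: caratheodory_type (vol_outer Om)]
    (fun t => (t : X) ord0 i).
Proof.
apply: caratheodory_measurable_fun => c; apply: outer_restr_caratheodory.
exact: leb_outer_coord.
Qed.

Lemma surf_coord_measurable (Om : set X) (i : 'I_n) :
  measurable_fun [set: caratheodory_type (surf_outer Om)]
    (fun t => (t : X) ord0 i).
Proof.
apply: caratheodory_measurable_fun => c; apply: outer_restr_caratheodory.
exact: hausdorff_outer_coord.
Qed.

End coordinate_measurability.

(** * Open sets and continuous functions are measurable on the domain *)

Section continuous_functions.
Context (R : realType) (n : nat).
Local Notation X := 'rV[R]_n.

Lemma coord_normr_le (x : X) (i : 'I_n) : `|x ord0 i| <= `|x|.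
Proof.
rewrite [leRHS]/Num.norm /= mx_normrE.
by apply/bigmax_geP; right => /=; exists (ord0, i).
Qed.

(** An open set is the countable union of the sup-norm cubes with rational centre and radius 1/(k+1)
    that it contains; a cube is a finite intersection of coordinate preimages. *)
Lemma vol_open_measurable (Om O : set X) : open O ->
  measurable (O : set (caratheodory_type (vol_outer Om))).
Proof.
move=> oO; pose V := caratheodory_type (vol_outer Om).
pose B (p : 'rV[rat]_n * nat) : set V :=
  [set t : X | forall i, `|t ord0 i - ratr (p.1 ord0 i)| < p.2.+1%:R^-1].
have mB p : measurable (B p).
  rewrite (_ : B p = \bigcap_(i in [set: 'I_n])
      ((fun t : V => (t : X) ord0 i) @^-1`
        ball (ratr (p.1 ord0 i) : R) p.2.+1%:R^-1)).
    apply: fin_bigcap_measurable; first exact: finite_finset.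
    move=> i _; rewrite -[X in measurable X]setTI.
    by apply: vol_coord_measurable => //; exact: measurable_ball.
  by apply/seteqP; split=> [t Bt i _|t Bt i]; have := Bt i;
    rewrite /ball/= distrC; [apply|apply].
rewrite (_ : O = \bigcup_p (if `[< B p `<=` O >] then B p else set0)).
  apply: countable_bigcupT_measurable; first exact: countableP.
  by move=> p; case: ifP.
apply/seteqP; split => t; last first.
  by move=> [p _]; case: asboolP => // BO; exact: BO.
move=> Ot.
have [e /= e0 eO] := (nbhs_ballP _ _).1 (open_nbhs_nbhs (conj oO Ot)).
(* The cube contains t within 1/(k+1) of its centre, so it lies within 2/(k+1) < e of t. *)
have [k ke] := ltr_add_invr (divr_gt0 e0 (@ltr0n R 2)); rewrite add0r in ke.
have k0 : 0 < k.+1%:R^-1 :> R by rewrite invr_gt0 ltr0n.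
have qP i : {q : rat | `|t ord0 i - ratr q| < k.+1%:R^-1}.
  apply: cid; have [|q] := @rat_in_itvoo R (t ord0 i - k.+1%:R^-1)
    (t ord0 i + k.+1%:R^-1).
    by rewrite ltrBlDr -addrA ltrDl addr_gt0.
  by rewrite in_itv/= => qt; exists q; rewrite ltr_distlC.
pose p : 'rV[rat]_n * nat := (\row_i sval (qP i), k).
exists p => //; rewrite asboolT; last first.
  move=> s Bs; apply: eO; split => // i j; rewrite (ord1 i).
  have qj := svalP (qP j); have := Bs j; rewrite /ball/= mxE distrC => sj.
  apply: le_lt_trans (ler_distD (ratr (sval (qP j))) _ _) _.
  by rewrite [ltRHS]splitr; apply: (lt_trans (ltrD qj sj)); exact: ltrD.
by move=> i; rewrite !mxE; exact: (svalP (qP i)).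
Qed.

Lemma vol_continuous_measurable (Om : set X) (g : X -> R) : continuous g ->
  measurable_fun [set: caratheodory_type (vol_outer Om)] g.
Proof.
move=> cg.
apply: (measurability _ (RGenOInfty.measurableE R)).
move=> _ [_ [c ->] <-]; rewrite setTI; apply: vol_open_measurable.
by move/continuousP : cg; apply; exact: interval_open.
Qed.

Lemma bounded_closure (Om : set X) : bounded_set Om -> bounded_set (closure Om).
Proof.
(* One unit because bounds hold only strictly above M, one for the distance to a nearby point of
   [Om]. *)
move=> [M [_ OmM]]; exists (M + 2).
split => [|N MN x /= clx]; first exact: num_real.
have [y [Oy xy]] := clx _ (nbhsx_ballx x 1 ltr01).
have yM : `|y| <= M + 1 by apply: OmM => //; lra.
have : `|x| <= `|y| + `|x - y| by rewrite -{1}(subrK y x) addrC ler_normD.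
move: xy; rewrite -ball_normE/= => xy; move: yM MN xy; lra.
Qed.

(** A coefficient is prescribed only on the closure of [Om] and may be wild elsewhere. Its smooth
    extension g is measurable everywhere, and bounded on the compact closure. *)
Lemma smooth_closure_bounded (Om : set X) (f : X -> R) :
  bounded_set Om -> smooth_closure Om f ->
  exists g : X -> R, [/\
    measurable_fun [set: caratheodory_type (vol_outer Om)] g,
    forall x, closure Om x -> f x = g x &
    exists C, forall x, closure Om x -> `|g x| <= C].
Proof.
move=> bOm [g sg fg]; exists g; have cg : continuous g.
  by move=> x; have [] := sg [::] x I.
split=> //; first exact: vol_continuous_measurable.
have : bounded_set (g @` closure Om).
  apply: (@compact_bounded R R^o); apply: continuous_compact.
    by apply: continuous_subspaceT => x; exact: cg.
  apply: bounded_closed_compact; first exact: bounded_closure.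
  exact: closed_closure.
move=> [M [_ gM]]; exists (M + 1) => x clx.
by apply: (gM (M + 1)); [lra|exists x].
Qed.

End continuous_functions.

(** * Complex-valued square integrable functions *)

Section complex_arithmetic.
Context (R : realType).
Implicit Types x y : R[i].

Lemma ReD x y : Re (x + y) = Re x + Re y. Proof. by case: x; case: y. Qed.
Lemma ImD x y : Im (x + y) = Im x + Im y. Proof. by case: x; case: y. Qed.
Lemma ReN x : Re (- x) = - Re x. Proof. by case: x. Qed.
Lemma ImN x : Im (- x) = - Im x. Proof. by case: x. Qed.
Lemma ReM x y : Re (x * y) = Re x * Re y - Im x * Im y.
Proof. by case: x; case: y. Qed.
Lemma ImM x y : Im (x * y) = Re x * Im y + Im x * Re y.
Proof. by case: x; case: y. Qed.
Lemma Re_conj x : Re x^* = Re x. Proof. by case: x. Qed.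
Lemma Im_conj x : Im x^* = - Im x. Proof. by case: x. Qed.

Definition reimE := (ReD, ImD, ReN, ImN, ReM, ImM, Re_conj, Im_conj).

Lemma complex_eq x y : Re x = Re y -> Im x = Im y -> x = y.
Proof. by case: x => ? ?; case: y => ? ? /= -> ->. Qed.

Lemma conjD x y : (x + y)^* = x^* + y^*.
Proof. by apply: complex_eq; rewrite !reimE// opprD. Qed.

Lemma sqmod_ge0 x : 0 <= sqmod x.
Proof. by rewrite addr_ge0// sqr_ge0. Qed.

Lemma sqmod0 : sqmod (0 : R[i]) = 0.
Proof. by rewrite /sqmod /= expr0n addr0. Qed.

Lemma sqmod_eq0 x : sqmod x = 0 -> x = 0.
Proof.
move=> /eqP; rewrite paddr_eq0 ?sqr_ge0// !sqrf_eq0 => /andP[/eqP r0 /eqP i0].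
exact: complex_eq.
Qed.

Lemma sqmodM x y : sqmod (x * y) = sqmod x * sqmod y.
Proof. by rewrite /sqmod !reimE; ring. Qed.

Lemma sqmodN x : sqmod (- x) = sqmod x.
Proof. by rewrite /sqmod !reimE !sqrrN. Qed.

Lemma sqmod_real (r : R) : sqmod r%:C = r ^+ 2.
Proof. by rewrite /sqmod /= expr0n addr0. Qed.

Lemma sqmodD_le x y : sqmod (x + y) <= 2 * sqmod x + 2 * sqmod y.
Proof.
rewrite /sqmod !reimE.
have := sqr_ge0 (Re x - Re y); have := sqr_ge0 (Im x - Im y); nra.
Qed.

Lemma cmod_le (x : R[i]) : cmod x <= `|Re x| + `|Im x|.
Proof.
rewrite /cmod -[leRHS]ger0_norm ?addr_ge0// -sqrtr_sqr ler_wsqrtr//.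
rewrite /sqmod -[Re x ^+ 2]real_normK ?num_real//.
rewrite -[Im x ^+ 2]real_normK ?num_real//.
by have := normr_ge0 (Re x); have := normr_ge0 (Im x); nra.
Qed.

End complex_arithmetic.

Section L2_theory.
Context d (T : measurableType d) (R : realType).
Variable mu : {measure set T -> \bar R}.
Implicit Types f g h : T -> R[i].
Local Notation int f := (mu.-integrable [set: T] (EFin \o f)).
Local Notation N := (L2_norm mu).
Local Notation L2 := (L2 mu).
Local Notation ip := (L2_ip mu).

Lemma integrableRZ (r : R) (k : T -> R) : int k -> int (fun x => r * k x).
Proof. by move=> ik; exact: (integrableZl measurableT r ik). Qed.

Lemma integrableRN (k : T -> R) : int k -> int (fun x => - k x).
Proof. by move=> ik; exact: (integrableN ik). Qed.

Lemma integrableRD (k l : T -> R) : int k -> int l -> int (fun x => k x + l x).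
Proof. by move=> ik il; exact: (integrableD measurableT ik il). Qed.

Definition cintegrable f :=
  int (fun x => Re (f x)) /\ int (fun x => Im (f x)).

Lemma cintegral_lin z f g : cintegrable f -> cintegrable g ->
  cintegral mu (fun x => z * f x + g x) = z * cintegral mu f + cintegral mu g.
Proof.
move=> [fr fi] [gr gi].
have Zi := integrableRZ; have Ni := integrableRN; have Di := integrableRD.
have RN (k : T -> R) : int k -> Rintegral mu setT (fun x => - k x) =
    - Rintegral mu setT k.
  move=> ik; rewrite -mulN1r -RintegralZl//.
  by apply: eq_Rintegral => x _; rewrite mulN1r.
apply: complex_eq; rewrite !reimE /=.
  under eq_Rintegral do rewrite !reimE.
  rewrite RintegralD//; last by apply: Di; [exact: Zi|exact/Ni/Zi].
  rewrite RintegralD//; [|exact: Zi|exact/Ni/Zi].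
  by rewrite RN ?RintegralZl//; exact: Zi.
under eq_Rintegral do rewrite !reimE.
rewrite RintegralD//; last by apply: Di; exact: Zi.
by rewrite RintegralD//; [|exact: Zi|exact: Zi]; rewrite !RintegralZl.
Qed.

Lemma L2_measurable_sqmod f : L2 f ->
  measurable_fun setT (fun x => sqmod (f x)).
Proof. by move=> [mr mi _]; apply: measurable_funD; exact: measurable_funX. Qed.

Lemma L2_integrable f : L2 f -> int (fun x => sqmod (f x)).
Proof.
move=> Lf; apply/integrableP; split.
  exact/measurable_EFinP/L2_measurable_sqmod.
have [_ _] := Lf; congr (_ < _)%E; apply: eq_integral => x _.
by rewrite /= ger0_norm// sqmod_ge0.
Qed.

Lemma L2_dominated f (k : T -> R) :
  measurable_fun setT (fun x => Re (f x)) ->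
  measurable_fun setT (fun x => Im (f x)) ->
  int k -> (forall x, sqmod (f x) <= k x) -> L2 f.
Proof.
move=> mr mi ik fk; split => //.
have ms : measurable_fun setT (fun x => (sqmod (f x))%:E).
  by apply/measurable_EFinP; apply: measurable_funD; exact: measurable_funX.
have /integrableP[mk] := ik; apply: le_lt_trans.
apply: ge0_le_integral => //.
- by move=> x _; rewrite lee_fin sqmod_ge0.
- exact: measurableT_comp.
- by move=> x _; rewrite lee_fin (le_trans (fk x))// ler_norm.
Qed.

Lemma L2_lin z f g : L2 f -> L2 g -> L2 (fun x => z * f x + g x).
Proof.
move=> Lf Lg; have [fr fi _] := Lf; have [gr gi _] := Lg.
apply: (@L2_dominated _ (fun x => 2 * sqmod z * sqmod (f x) + 2 * sqmod (g x))).
- under eq_fun do rewrite !reimE; apply: measurable_funD => //.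
  by apply: measurable_funB; exact: measurable_funM.
- under eq_fun do rewrite !reimE; apply: measurable_funD => //.
  by apply: measurable_funD; exact: measurable_funM.
- apply: integrableRD.
    by apply: integrableRZ; exact: L2_integrable.
  by apply: integrableRZ; exact: L2_integrable.
- by move=> x; rewrite -mulrA -sqmodM; exact: sqmodD_le.
Qed.

Lemma L2_0 : L2 (fun=> 0).
Proof.
split; [exact: measurable_cst|exact: measurable_cst|].
by under eq_integral do rewrite sqmod0; rewrite integral0.
Qed.

Lemma L2_Z z f : L2 f -> L2 (fun x => z * f x).
Proof.
by move=> Lf; have := L2_lin z Lf L2_0; under eq_fun do rewrite addr0.
Qed.

Lemma L2_D f g : L2 f -> L2 g -> L2 (fun x => f x + g x).
Proof.
by move=> Lf; move/(L2_lin 1 Lf); under eq_fun do rewrite mul1r.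
Qed.

Lemma L2_N f : L2 f -> L2 (fun x => - f x).
Proof. by move/(L2_Z (-1)); under eq_fun do rewrite mulN1r. Qed.

Lemma L2_B f g : L2 f -> L2 g -> L2 (fun x => f x - g x).
Proof. by move=> Lf /L2_N; exact: L2_D. Qed.

Lemma L2_cintegrable f g : L2 f -> L2 g -> cintegrable (fun x => f x * (g x)^*).
Proof.
move=> Lf Lg; have [fr fi _] := Lf; have [gr gi _] := Lg.
have iS : int (fun x => sqmod (f x) + sqmod (g x)).
  by apply: integrableRD; exact: L2_integrable.
split; apply: (le_integrable measurableT _ _ iS).
- apply/measurable_EFinP; under eq_fun do rewrite !reimE.
  apply: measurable_funB; apply: measurable_funM => //.
  exact: measurable_funN.
- move=> x _; rewrite lee_fin [leRHS]ger0_norm; last first.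
    exact: addr_ge0 (sqmod_ge0 _) (sqmod_ge0 _).
  rewrite !reimE /sqmod ler_norml.
  have := sqr_ge0 (Re (f x) - Re (g x)); have := sqr_ge0 (Im (f x) - Im (g x)).
  have := sqr_ge0 (Re (f x) + Re (g x)); have := sqr_ge0 (Im (f x) + Im (g x)).
  by move: (Re (f x)) (Re (g x)) (Im (f x)) (Im (g x)) => a b c e; nra.
- apply/measurable_EFinP; under eq_fun do rewrite !reimE.
  apply: measurable_funD; apply: measurable_funM => //.
  exact: measurable_funN.
- move=> x _; rewrite lee_fin [leRHS]ger0_norm; last first.
    exact: addr_ge0 (sqmod_ge0 _) (sqmod_ge0 _).
  rewrite !reimE /sqmod ler_norml.
  have := sqr_ge0 (Re (f x) - Im (g x)); have := sqr_ge0 (Im (f x) - Re (g x)).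
  have := sqr_ge0 (Re (f x) + Im (g x)); have := sqr_ge0 (Im (f x) + Re (g x)).
  by move: (Re (f x)) (Re (g x)) (Im (f x)) (Im (g x)) => a b c e; nra.
Qed.

Lemma L2_ip_lin z f f' g : L2 f -> L2 f' -> L2 g ->
  ip (fun x => z * f x + f' x) g = z * ip f g + ip f' g.
Proof.
move=> Lf Lf' Lg; rewrite /L2_ip -cintegral_lin; [|exact: L2_cintegrable..].
by congr (cintegral mu _); apply/funext => x; rewrite mulrDl mulrA.
Qed.

Lemma L2_ip_conj f g : L2 f -> L2 g -> ip g f = (ip f g)^*.
Proof.
move=> Lf Lg; apply: complex_eq; rewrite !reimE /=.
  by apply: eq_Rintegral => x _; rewrite !reimE; ring.
rewrite -mulN1r -RintegralZl//; last by have [] := L2_cintegrable Lf Lg.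
by apply: eq_Rintegral => x _; rewrite !reimE; ring.
Qed.

Lemma cintegral_ae f g : cintegrable f -> cintegrable g -> ae_same mu f g ->
  cintegral mu f = cintegral mu g.
Proof.
move=> [/integrableP[fr _] /integrableP[fi _]].
move=> [/integrableP[gr _] /integrableP[gi _]] fg.
rewrite /cintegral; congr (_ +i* _); congr fine; apply: ae_eq_integral => //.
  by apply: filterS fg => x fgx _ /=; rewrite fgx.
by apply: filterS fg => x fgx _ /=; rewrite fgx.
Qed.

Lemma L2_ip_ae f f' g g' : L2 f -> L2 f' -> L2 g -> L2 g' ->
  ae_same mu f f' -> ae_same mu g g' -> ip f g = ip f' g'.
Proof.
move=> Lf Lf' Lg Lg' ff' gg'; apply: cintegral_ae; [exact: L2_cintegrable..|].
by apply: filterS2 ff' gg' => x -> ->.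
Qed.

Lemma L2_norm_ge0 f : 0 <= N f. Proof. exact: sqrtr_ge0. Qed.

Lemma L2_normE f : N f ^+ 2 = Rintegral mu setT (fun x => sqmod (f x)).
Proof.
by rewrite /L2_norm sqr_sqrtr// Rintegral_ge0// => x _; exact: sqmod_ge0.
Qed.

Lemma L2_normE_ip f : N f ^+ 2 = Re (ip f f).
Proof.
rewrite L2_normE /=; apply: eq_Rintegral => x _.
by rewrite /sqmod !reimE; ring.
Qed.

Lemma L2_norm_ae f g : L2 f -> L2 g -> ae_same mu f g -> N f = N g.
Proof.
move=> Lf Lg fg; rewrite /L2_norm; congr Num.sqrt; congr fine.
apply: ae_eq_integral => //.
- exact/measurable_EFinP/L2_measurable_sqmod.
- exact/measurable_EFinP/L2_measurable_sqmod.
- by apply: filterS fg => x -> _.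
Qed.

Lemma L2_normZ z f : L2 f -> N (fun x => z * f x) = cmod z * N f.
Proof.
move=> Lf; rewrite /L2_norm /cmod -sqrtrM ?sqmod_ge0//; congr Num.sqrt.
rewrite -RintegralZl//; last exact: L2_integrable.
by apply: eq_Rintegral => x _; rewrite sqmodM.
Qed.

Lemma L2_norm_eq0 f : L2 f -> N f = 0 -> ae_same mu f (fun=> 0).
Proof.
move=> Lf Nf; have : N f ^+ 2 = 0 by rewrite Nf expr0n.
rewrite L2_normE => /eqP; rewrite fine_eq0; last first.
  exact: integrable_fin_num (L2_integrable Lf).
move=> /eqP s0.
have /(ae_eq_integral_abs mu measurableT) : measurable_fun setT
    (fun x => (sqmod (f x))%:E).
  exact/measurable_EFinP/L2_measurable_sqmod.
move=> [/(_ _)+ _]; move=> /(_ _)[].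
  rewrite -[RHS]s0; apply: eq_integral => x _.
  by rewrite gee0_abs// lee_fin sqmod_ge0.
move=> A [mA A0 fA]; exists A; split => // x /= f0; apply: fA => /= fx.
by apply: f0; apply: sqmod_eq0; have [] := fx I.
Qed.

Lemma L2_ip_D2 f g h : L2 f -> L2 g -> L2 h ->
  ip f (fun x => g x + h x) = ip f g + ip f h.
Proof.
move=> Lf Lg Lh; rewrite (L2_ip_conj (L2_D Lg Lh) Lf).
have := L2_ip_lin 1 Lg Lh Lf; under eq_fun do rewrite mul1r.
move=> ->; rewrite mul1r conjD.
by rewrite [in RHS](L2_ip_conj Lg Lf) (L2_ip_conj Lh Lf).
Qed.

Lemma L2_ip_D1 f g h : L2 f -> L2 g -> L2 h ->
  ip (fun x => f x + g x) h = ip f h + ip g h.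
Proof.
move=> Lf Lg Lh; have := L2_ip_lin 1 Lf Lg Lh.
by under eq_fun do rewrite mul1r; rewrite mul1r.
Qed.

Lemma L2_ip_Z1 z f g : L2 f -> L2 g -> ip (fun x => z * f x) g = z * ip f g.
Proof.
move=> Lf Lg; have := L2_ip_lin z Lf L2_0 Lg.
under eq_fun do rewrite addr0; move=> ->.
suff -> : ip (fun=> 0) g = 0 by rewrite addr0.
have := L2_ip_lin (-1) Lf Lf Lg.
under eq_fun do rewrite mulN1r addNr.
by move=> ->; rewrite mulN1r addNr.
Qed.

Lemma L2_norm_sq_D (s : R) f g : L2 f -> L2 g ->
  N (fun x => s%:C * f x + g x) ^+ 2 =
  s ^+ 2 * N f ^+ 2 + 2 * s * Re (ip f g) + N g ^+ 2.
Proof.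
move=> Lf Lg; have Ls := L2_Z s%:C Lf; have Lsg := L2_lin s%:C Lf Lg.
rewrite !L2_normE_ip L2_ip_lin// L2_ip_D2// L2_ip_D2// !reimE.
rewrite (L2_ip_conj Ls Lf) (L2_ip_conj Ls Lg) !L2_ip_Z1// !reimE/=.
by ring.
Qed.

(** The squared norm of s f + g is a nonnegative real quadratic in s; it is evaluated at its
    minimizer. *)
Lemma L2_CauchySchwarz_Re f g : L2 f -> L2 g -> `|Re (ip f g)| <= N f * N g.
Proof.
move=> Lf Lg; set x := Re _.
have q s : 0 <= s ^+ 2 * N f ^+ 2 + 2 * s * x + N g ^+ 2.
  by rewrite -L2_norm_sq_D// sqr_ge0.
have [A0|A0] := eqVneq (N f) 0.
  have [->|x0] := eqVneq x 0; first by rewrite normr0 A0 mul0r.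
  (* With [N f = 0] the quadratic is affine in s; this s would give it the value -1. *)
  have := q (- (N g ^+ 2 + 1) / (2 * x)); rewrite A0 expr0n mulr0 add0r.
  by rewrite (_ : 2 * _ * x = - (N g ^+ 2 + 1)); [lra|field].
have Agt0 : 0 < N f by rewrite lt_neqAle eq_sym A0 L2_norm_ge0.
rewrite -(@ler_pXn2r _ 2) ?nnegrE ?mulr_ge0 ?L2_norm_ge0//.
rewrite real_normK ?num_real// exprMn.
have := q (- x / N f ^+ 2).
have -> : (- x / N f ^+ 2) ^+ 2 * N f ^+ 2 + 2 * (- x / N f ^+ 2) * x + N g ^+ 2
  = N g ^+ 2 - x ^+ 2 / N f ^+ 2 by field.
by rewrite subr_ge0 ler_pdivrMr ?exprn_gt0// mulrC.
Qed.

(** Multiplying f by -i turns the imaginary part of the pairing into the real part. *)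
Lemma L2_CauchySchwarz_Im f g : L2 f -> L2 g -> `|Im (ip f g)| <= N f * N g.
Proof.
move=> Lf Lg; have := L2_CauchySchwarz_Re (L2_Z (- 'i) Lf) Lg.
rewrite L2_ip_Z1// L2_normZ// !reimE/=.
rewrite (_ : cmod (- 'i) = 1) ?mul1r; last first.
  by rewrite /cmod sqmodN /sqmod /= expr0n expr1n add0r sqrtr1.
by rewrite oppr0 mul0r sub0r mulN1r opprK.
Qed.

Lemma L2_cmod_ip f g : L2 f -> L2 g -> cmod (ip f g) <= 2 * (N f * N g).
Proof.
move=> Lf Lg; apply: le_trans (cmod_le _) _.
have := L2_CauchySchwarz_Re Lf Lg; have := L2_CauchySchwarz_Im Lf Lg; lra.
Qed.

Lemma L2_norm_triangle f g : L2 f -> L2 g ->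
  N (fun x => f x + g x) <= N f + N g.
Proof.
move=> Lf Lg; rewrite -(@ler_pXn2r _ 2) ?nnegrE ?addr_ge0 ?L2_norm_ge0//.
have := L2_norm_sq_D 1 Lf Lg; under eq_fun do rewrite mul1r.
move=> ->; have := ler_norm (Re (ip f g)); have := L2_CauchySchwarz_Re Lf Lg.
by rewrite expr1n sqrrD; lra.
Qed.

End L2_theory.

(** * Essentially bounded real multipliers on L^2 *)

Section bounded_multipliers.
Context d (T : measurableType d) (R : realType).
Variable mu : {measure set T -> \bar R}.
Implicit Types (f g : T -> R[i]) (h : T -> R).
Local Notation N := (L2_norm mu).
Local Notation L2 := (L2 mu).

Lemma aeS (P Q : set T) : (forall x, P x -> Q x) ->
  {ae mu, forall x, P x} -> {ae mu, forall x, Q x}.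
Proof. by move=> PQ; apply: filterS. Qed.

Lemma aeS2 (P Q S : set T) : (forall x, P x -> Q x -> S x) ->
  {ae mu, forall x, P x} -> {ae mu, forall x, Q x} -> {ae mu, forall x, S x}.
Proof. by move=> PQS aP aQ; apply: filterS2 aP aQ. Qed.

Lemma ae_same_refl f : ae_same mu f f.
Proof. exact: aeW. Qed.

Lemma Lnormoo_ae h r : (Lnorm mu +oo (EFin \o h) <= r%:E)%E ->
  {ae mu, forall x, `|h x| <= r}.
Proof.
rewrite unlock; case: ifPn => [_ /ess_supP|].
  by apply: filterS => x /=; rewrite lee_fin.
(* The whole space is null here, so it serves as the exceptional set. *)
rewrite -leNgt => mu0 _; exists setT; split => //.
by apply/eqP; rewrite eq_le mu0 measure_ge0.
Qed.

Lemma Linfty_ae h : Linfty mu h ->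
  measurable_fun [set: T] h /\
  exists2 r, 0 <= r & {ae mu, forall x, `|h x| <= r}.
Proof.
move=> [mh hoo]; split => //.
have [r hr] : exists r : R, (Lnorm mu +oo (EFin \o h) <= r%:E)%E.
  move: hoo; case: (Lnorm _ _ _) => [r _|//|_]; first by exists r.
  by exists 0; rewrite leNye.
exists (Num.max 0 r); first by rewrite le_max lexx.
by apply: filterS (Lnormoo_ae hr) => x hx; rewrite le_max hx orbT.
Qed.

Lemma L2_mulr h r f : measurable_fun [set: T] h -> 0 <= r ->
  {ae mu, forall x, `|h x| <= r} -> L2 f ->
  L2 (fun x => (h x)%:C * f x) /\ N (fun x => (h x)%:C * f x) <= r * N f.
Proof.
move=> mh r0 hr Lf; have [fr fi _] := Lf.
have m1 : measurable_fun [set: T] (fun x => Re ((h x)%:C * f x)).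
  under eq_fun do rewrite !reimE /= mul0r subr0.
  exact: measurable_funM.
have m2 : measurable_fun [set: T] (fun x => Im ((h x)%:C * f x)).
  under eq_fun do rewrite !reimE /= mul0r addr0.
  exact: measurable_funM.
have ms : measurable_fun [set: T] (fun x => (sqmod ((h x)%:C * f x))%:E).
  by apply/measurable_EFinP; apply: measurable_funD; exact: measurable_funX.
have ik : mu.-integrable [set: T] (EFin \o (fun x => r ^+ 2 * sqmod (f x))).
  by apply: integrableRZ; exact: L2_integrable.
have le : (\int[mu]_x (sqmod ((h x)%:C * f x))%:E <=
           \int[mu]_x (r ^+ 2 * sqmod (f x))%:E)%E.
  apply: ae_ge0_le_integral => //.
  - by move=> x _; rewrite lee_fin sqmod_ge0.
  - by move=> x _; rewrite lee_fin mulr_ge0 ?sqr_ge0 ?sqmod_ge0.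
  - by have /integrableP[] := ik.
  - apply: filterS hr => x hx _; rewrite lee_fin sqmodM sqmod_real.
    rewrite ler_wpM2r ?sqmod_ge0// -(real_normK (num_real (h x))).
    by rewrite ler_pXn2r ?nnegrE.
have L : L2 (fun x => (h x)%:C * f x).
  split => //; apply: (le_lt_trans le).
  have /integrableP[_] := ik; congr (_ < _)%E; apply: eq_integral => x _ /=.
  by rewrite ger0_norm// mulr_ge0 ?sqr_ge0 ?sqmod_ge0.
split => //; rewrite -(@ler_pXn2r _ 2) ?nnegrE ?mulr_ge0 ?L2_norm_ge0//.
rewrite exprMn !L2_normE -RintegralZl//; last exact: L2_integrable.
apply: fine_le => //.
- exact: integrable_fin_num (L2_integrable L).
- exact: integrable_fin_num ik.
Qed.

Lemma L2_ip_mulr h f g :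
  L2_ip mu (fun x => (h x)%:C * f x) g = L2_ip mu f (fun x => (h x)%:C * g x).
Proof.
congr cintegral; apply/funext => x.
by apply: complex_eq; rewrite !reimE /=; ring.
Qed.

(** Completeness of the measure transfers measurability across an almost everywhere equality. *)
Lemma L2_complete f g : measure_is_complete mu -> L2 f -> ae_same mu f g ->
  L2 g.
Proof.
move=> cmu Lf fg; have [fr fi foo] := Lf.
have mr : measurable_fun [set: T] (fun x => Re (g x)).
  apply/measurable_EFinP; move/measurable_EFinP : fr.
  apply: (ae_measurable_fun cmu).
  by apply: filterS fg => x /= -> _.
have mi : measurable_fun [set: T] (fun x => Im (g x)).
  apply/measurable_EFinP; move/measurable_EFinP : fi.
  apply: (ae_measurable_fun cmu).
  by apply: filterS fg => x /= -> _.
split => //; apply: le_lt_trans foo.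
rewrite le_eqVlt; apply/orP; left; apply/eqP; apply: ge0_ae_eq_integral => //.
- by apply/measurable_EFinP; apply: measurable_funD; exact: measurable_funX.
- by apply/measurable_EFinP; exact: (L2_measurable_sqmod Lf).
- by move=> x _; rewrite lee_fin sqmod_ge0.
- by move=> x _; rewrite lee_fin sqmod_ge0.
- by apply: filterS fg => x -> _.
Qed.

End bounded_multipliers.

(** * Null sets of restricted outer measures *)

Section restricted_measure.
Context (R : realType) (T : pointedType).

Lemma caratheodory_null (mu : {outer_measure set T -> \bar R}) (A : set T) :
  mu A = 0%E -> mu.-caratheodory A.
Proof.
move=> A0; apply: le_caratheodory_measurable => X.
rewrite (_ : mu (X `&` A) = 0%E) ?add0e.
  by apply: le_outer_measure; exact: subIsetl.
apply/eqP; rewrite eq_le outer_measure_ge0 andbT -A0.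
by apply: le_outer_measure; exact: subIsetr.
Qed.

(** Representatives live on all of R^n; this discards their values off D, whose complement is null
    for the restricted measure. *)
Lemma outer_restr_ae (mu : {outer_measure set T -> \bar R}) (D P : set T) :
  (forall x, D x -> P x) ->
  {ae (outer_restr mu D : set (caratheodory_type (outer_restr mu D)) -> \bar R),
    forall x, P x}.
Proof.
move=> DP; have D0 : outer_restr mu D (~` D) = 0%E.
  by rewrite /outer_restr setICl outer_measure0.
exists (~` D); split => //.
  exact: caratheodory_null.
by move=> x /= nP /DP.
Qed.

End restricted_measure.

(** * The space H^1/2 of the boundary *)

Section unmeasured_integrals.
Context d (T : measurableType d) (R : realType).
Local Open Scope ereal_scope.

(** The integral of a nonnegative function is a supremum over simple functions below it, so
    monotonicity holds without measurability. This matters for inner integrals that Tonelli does not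
    yet cover. *)
Lemma ge0_integral_mono (mu : {measure set T -> \bar R}) (f g : T -> \bar R) :
  (forall x, 0 <= f x) -> (forall x, f x <= g x) ->
  \int[mu]_x f x <= \int[mu]_x g x.
Proof.
move=> f0 fg; rewrite !ge0_integralTE//; last first.
  by move=> x; exact: le_trans (f0 x) (fg x).
apply: ereal_sup_le => _ [h hf <-]; exists h => // x.
exact: le_trans (hf x) (fg x).
Qed.

(** Tonelli's theorem, with sigma-finiteness as a hypothesis: [nu] is [mu] repackaged with that
    structure, built on the fly. *)
Lemma sigma_finite_measurable_section (mu : {measure set T -> \bar R})
    (f : T * T -> \bar R) :
  sigma_finite setT mu -> measurable_fun setT f -> (forall z, 0 <= f z) ->
  measurable_fun setT (fun x => \int[mu]_y f (x, y)).
Proof.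
move=> sf mf f0.
pose Hsf := isSFinite.Build _ _ _ (mu : set T -> \bar R)
  (sfinite_measure_sigma_finite sf).
pose Hsig := isSigmaFinite.Build _ _ _ (mu : set T -> \bar R) sf.
pose nu := HB.pack_for (SigmaFiniteMeasure.type T R) (Measure.sort mu) Hsf Hsig.
exact: (@measurable_fun_fubini_tonelli_F _ _ _ _ _ nu f mf f0).
Qed.

End unmeasured_integrals.

Section H12_linear.
Context (R : realType) (n : nat).
Local Notation X := 'rV[R]_n.
Variable Om : set X.
Hypothesis bOm : bounded_set Om.
Local Notation mu := (surf Om).
Local Notation V := (caratheodory_type (surf_outer Om)).
Implicit Types f g : X -> R[i].

Definition slob_kernel g (x y : X) : R :=
  sqmod (g x - g y) / enorm (x - y) ^+ n.

Lemma enorm_ge0 (x : X) : 0 <= enorm x.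
Proof. exact: sqrtr_ge0. Qed.

Lemma slob_kernel_ge0 g x y : 0 <= slob_kernel g x y.
Proof. by rewrite divr_ge0 ?sqmod_ge0// exprn_ge0// enorm_ge0. Qed.

Lemma measurable_slob_kernel g :
  measurable_fun [set: V] (fun x => Re (g x)) ->
  measurable_fun [set: V] (fun x => Im (g x)) ->
  measurable_fun [set: V * V] (fun z => (slob_kernel g z.1 z.2)%:E).
Proof.
move=> mr mi; apply/measurable_EFinP; apply: measurable_funM.
  under eq_fun do rewrite /sqmod !reimE.
  apply: measurable_funD; apply: measurable_funX; apply: measurable_funB.
  - exact: (measurableT_comp mr measurable_fst).
  - exact: (measurableT_comp mr measurable_snd).
  - exact: (measurableT_comp mi measurable_fst).
  - exact: (measurableT_comp mi measurable_snd).
pose D (z : V * V) : R := \sum_i ((z.1 : X) ord0 i - (z.2 : X) ord0 i) ^+ 2.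
have mD : measurable_fun [set: V * V] D.
  apply: measurable_sum => i.
  have m1 : measurable_fun [set: V * V] (fun z => (z.1 : X) ord0 i).
    exact: (measurableT_comp (surf_coord_measurable i) measurable_fst).
  have m2 : measurable_fun [set: V * V] (fun z => (z.2 : X) ord0 i).
    exact: (measurableT_comp (surf_coord_measurable i) measurable_snd).
  by apply: measurable_funX; exact: measurable_funB.
(* The reciprocal power of the distance is written with real powers of the squared distance, whose
   measurability is known also at 0. *)
rewrite (_ : (fun z => _) = (fun z => (D z `^ 2^-1) `^ (- n%:R))).
  apply: (measurableT_comp (measurable_powR _)).
  exact: (measurableT_comp (measurable_powR _)).
apply/funext => z; rewrite powRN powR_mulrn ?powR_ge0// powR12_sqrt.
  congr ((Num.sqrt _ ^+ _)^-1).
  by apply: eq_bigr => i _; rewrite !mxE.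
by apply: sumr_ge0 => i _; exact: sqr_ge0.
Qed.

Lemma bd_null : mu (~` bd Om) = 0%E.
Proof.
by rewrite /surf /= /outer_restr setICl outer_measure0.
Qed.

Lemma bd_measurable : measurable (bd Om : set V).
Proof.
rewrite -[bd Om]setCK; apply: measurableC.
by apply: caratheodory_null; exact: bd_null.
Qed.

Lemma bd_diam : exists2 D, 0 < D &
  forall x y : X, bd Om x -> bd Om y -> enorm (x - y) <= D.
Proof.
have [M [_ cM]] := bounded_closure bOm.
pose C := Num.max 1 (M + 1).
have C1 : 1 <= C by rewrite le_max lexx.
have cC x : closure Om x -> `|x| <= C.
  by apply: (cM C); rewrite lt_max; apply/orP; right; lra.
(* The square root bounds the Euclidean diameter through the sup norm; adding 1 makes the constant
   positive. *)
exists (Num.sqrt (n%:R * (2 * C) ^+ 2) + 1).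
  by rewrite ltr_wpDl// sqrtr_ge0.
move=> x y [cx _] [cy _]; rewrite -[leLHS]addr0 lerD// /enorm ler_wsqrtr//.
rewrite -[n in n%:R]card_ord -sum1_card natr_sum mulr_suml.
apply: ler_sum => i _; rewrite mul1r -real_normK ?num_real//.
rewrite ler_pXn2r ?nnegrE ?mulr_ge0//; last by lra.
apply: le_trans (coord_normr_le _ _) _; apply: le_trans (ler_normB _ _) _.
by have := cC _ cx; have := cC _ cy; lra.
Qed.

(* If the zero set Z of g had infinite area, then so would be the inner      *)
(* integral of the Slobodeckij seminorm at every boundary point outside Z,   *)
(* because the boundary is bounded.                                          *)
Lemma H12_sigma_finite g : H12 Om g -> ~ ae_same mu g (fun=> 0) ->
  sigma_finite setT mu.
Proof.
move=> [Lg sg] gn0; have [gr gi _] := Lg; have [D D0 bdD] := bd_diam.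
have ms := L2_measurable_sqmod Lg.
pose Z : set V := [set x | g x = 0] `&` bd Om.
have mZ : measurable Z.
  apply: measurableI; last exact: bd_measurable.
  rewrite (_ : [set x | g x = 0] = (fun x => sqmod (g x)) @^-1` [set 0]).
    by rewrite -[X in measurable X]setTI; exact: ms.
  by apply/seteqP; split => [x /= ->|x /= /sqmod_eq0//]; rewrite sqmod0.
have Zoo : (mu Z < +oo)%E.
  rewrite ltey; apply/eqP => Zoo; apply: gn0.
  (* For x on the boundary and y in Z the kernel is |g x|^2 / |x - y|^n, hence at least [k x].
     Integrating over an infinite Z forces k, and so g, to vanish almost everywhere. *)
  pose c := (D ^+ n)^-1; have c0 : 0 < c by rewrite invr_gt0 exprn_gt0.
  pose k x : R := c * sqmod (g x) * \1_(bd Om) x.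
  have k0 x : 0 <= k x by rewrite !mulr_ge0 ?sqmod_ge0// ltW.
  have mk : measurable_fun [set: V] k.
    apply: measurable_funM; last first.
      by apply: measurable_indic; exact: bd_measurable.
    exact: measurable_funM.
  have le x : ((k x)%:E * mu Z <= \int[mu]_y (slob_kernel g x y)%:E)%E.
    have -> : ((k x)%:E * mu Z = \int[mu]_y ((k x)%:E * (\1_Z y)%:E))%E.
      have m1 : measurable_fun [set: V] (fun y => (\1_Z y)%:E : \bar R).
        by apply/measurable_EFinP; exact: measurable_indic.
      rewrite (ge0_integralZl mu measurableT m1).
      - by rewrite integral_indic// setIT.
      - by move=> y _; rewrite lee_fin.
      - by rewrite lee_fin.
    apply: ge0_integral_mono => y; first by rewrite mule_ge0// lee_fin.
    rewrite -EFinM lee_fin /k !indicE.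
    have [|_] := boolP (y \in Z); last by rewrite mulr0 slob_kernel_ge0.
    rewrite inE => -[/= gy bdy]; rewrite mulr1.
    have [|_] := boolP (x \in bd Om); last by rewrite mulr0 slob_kernel_ge0.
    rewrite inE => bdx; rewrite mulr1 /slob_kernel gy subr0 mulrC.
    have [->|xy] := eqVneq x y; first by rewrite gy sqmod0 !mul0r.
    rewrite ler_wpM2l ?sqmod_ge0// lef_pV2 ?posrE ?exprn_gt0//.
      by rewrite lerXn2r ?nnegrE ?enorm_ge0 ?(ltW D0)//; exact: bdD.
    rewrite lt_neqAle enorm_ge0 andbT eq_sym; apply: contra xy => /eqP e0.
    apply/eqP/rowP => i; apply/eqP; rewrite -subr_eq0 -normr_le0.
    have := coord_le_enorm (x - y) i; rewrite e0; congr (`|_| <= _).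
    by rewrite !mxE.
  have fin : (\int[mu]_x ((k x)%:E * mu Z) < +oo)%E.
    apply: le_lt_trans sg; apply: ge0_integral_mono => x; last exact: le.
    by rewrite mule_ge0// lee_fin.
  have ik0 : (\int[mu]_x (k x)%:E = 0)%E.
    apply/eqP; rewrite -[_ == _]negbK; apply/negP => ik.
    have mkE : measurable_fun [set: V] (fun x => (k x)%:E : \bar R).
      exact/measurable_EFinP.
    move: fin; rewrite (ge0_integralZr mu measurableT mkE); last 2 first.
    - by move=> x _; rewrite lee_fin.
    - exact: outer_measure_ge0.
    rewrite Zoo gt0_muley// lt_neqAle eq_sym ik.
    by apply: integral_ge0 => x _; rewrite lee_fin.
  have : ae_eq mu setT (fun x => (k x)%:E) (cst 0%E).
    apply/(ae_eq_integral_abs mu measurableT).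
      by apply/measurable_EFinP; exact: mk.
    by rewrite -[RHS]ik0; apply: eq_integral => x _; rewrite gee0_abs ?lee_fin.
  have : {ae mu, forall x, bd Om x} by exact: outer_restr_ae.
  apply: aeS2 => x bdx /(_ I) [] /eqP.
  rewrite /k indicE mem_set// mulr1 mulf_eq0 gt_eqF//= => /eqP.
  exact: sqmod_eq0.
(* Where g is nonzero the space is exhausted by these superlevel sets, of finite measure by Markov's
   inequality. Z and the null complement of the boundary complete the cover. *)
pose A k : set V := [set x | k.+1%:R^-1 <= sqmod (g x)].
have mA k : measurable (A k).
  rewrite (_ : A k = setT `&` (fun x => sqmod (g x)) @^-1` `[k.+1%:R^-1, +oo[).
    by apply: ms => //; exact: measurable_itv.
  by apply/seteqP; split => [x Ax|x [_]]; rewrite /= in_itv/= andbT.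
exists (fun k => (~` bd Om `|` Z) `|` A k).
  apply/seteqP; split => // x _.
  have [gx0|/eqP gx] := eqVneq (g x) 0.
    exists 0%N => //; left; have [bx|nbx] := pselect (bd Om x); last by left.
    by right.
  have : 0 < sqmod (g x).
    rewrite lt_neqAle sqmod_ge0 andbT eq_sym; apply/eqP => /sqmod_eq0.
    exact: gx.
  by move=> /ltr_add_invr[k]; rewrite add0r => /ltW kg; exists k => //; right.
move=> k; split.
  apply: measurableU => //; apply: measurableU => //; apply: measurableC.
  exact: bd_measurable.
apply: le_lt_trans (outer_measureU2 (surf_outer Om) _ _) _.
apply: lte_add_pinfty.
  apply: le_lt_trans (outer_measureU2 (surf_outer Om) _ _) _.
  by apply: lte_add_pinfty => //; rewrite [ltLHS]bd_null.
have k0 : 0 < k.+1%:R^-1 :> R by rewrite invr_gt0 ltr0n.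
have /integrableP[_ goo] := L2_integrable Lg.
have /measurable_EFinP ms' := ms.
have := le_integral_abse mu measurableT ms' k0.
move=> /le_lt_trans/(_ goo); rewrite setTI.
rewrite [X in mu X](_ : _ = A k); last first.
  by apply/seteqP; split => x /=; rewrite /A/= lee_fin ger0_norm// sqmod_ge0.
move=> h; apply/negPn; rewrite -leNgt leye_eq; apply/negP => /eqP muA.
have {}muA : mu (A k) = +oo%E := muA.
by move: h; rewrite muA gt0_muley ?lte_fin.
Qed.

Lemma slob_kernel_lin_le z f g x y :
  slob_kernel (fun t => z * f t + g t) x y <=
  2 * sqmod z * slob_kernel f x y + 2 * slob_kernel g x y.
Proof.
rewrite /slob_kernel !mulrA -mulrDl.
apply: ler_wpM2r; first by rewrite invr_ge0 exprn_ge0// enorm_ge0.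
rewrite -mulrA -sqmodM.
rewrite (_ : _ - _ = z * (f x - f y) + (g x - g y)); last by ring.
exact: sqmodD_le.
Qed.

(** The kernel of z f + g is dominated by those of f and g. Additivity of the outer integral on the
    dominating side needs measurable inner integrals, supplied by Tonelli when the surface measure
    is sigma-finite. Otherwise f and g vanish almost everywhere by [H12_sigma_finite], and the
    seminorm is 0. *)
Lemma H12_lin z f g : H12 Om f -> H12 Om g -> H12 Om (fun x => z * f x + g x).
Proof.
move=> Hf Hg; have [Lf sf] := Hf; have [Lg sg] := Hg.
have Lh := L2_lin z Lf Lg; split; first exact: Lh.
have [sfin|nsf] := pselect (sigma_finite setT mu); last first.
  have f0 : ae_same mu f (fun=> 0).
    by apply: contrapT => nf0; apply/nsf/(H12_sigma_finite Hf).
  have g0 : ae_same mu g (fun=> 0).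
    by apply: contrapT => ng0; apply/nsf/(H12_sigma_finite Hg).
  set h := fun x => z * f x + g x.
  have h0 : ae_same mu h (fun=> 0).
    by apply: aeS2 f0 g0 => x fx gx; rewrite /h fx gx mulr0 addr0.
  have [hr hi _] := Lh.
  have mk := measurable_slob_kernel hr hi.
  suff F0 : ae_eq mu setT
      (fun x => \int[mu]_y (slob_kernel h x y)%:E)%E (cst 0%E).
    (* Without Tonelli, measurability comes from completeness: this function is zero almost
       everywhere. *)
    have mF : measurable_fun [set: V]
        (fun x => \int[mu]_y (slob_kernel h x y)%:E)%E.
      apply: (@ae_measurable_fun _ _ _ mu _ _ (cst 0%E)).
      - exact: measure_is_complete_caratheodory.
      - by apply: aeS F0 => x /= xE xT; rewrite xE.
      - exact: measurable_cst.
    rewrite /slobodeckij.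
    rewrite [X in (X < _)%E](ae_eq_integral (cst 0%E) _ measurableT mF _ F0).
      by rewrite integral0.
    exact: measurable_cst.
  apply: aeS (h0) => x hx _.
  have mkx : measurable_fun [set: V] (fun y => (slob_kernel h x y)%:E).
    exact: (measurableT_comp mk (pair1_measurable x)).
  rewrite (ae_eq_integral (cst 0%E) _ measurableT mkx); last 2 first.
  - exact: measurable_cst.
  - by apply: aeS h0 => y hy _; rewrite /slob_kernel hx hy subrr sqmod0 mul0r.
  by rewrite integral0.
have [fr fi _] := Lf; have [gr gi _] := Lg.
have mf := measurable_slob_kernel fr fi.
have mg := measurable_slob_kernel gr gi.
have mfx (x : V) : measurable_fun [set: V] (fun y => (slob_kernel f x y)%:E).
  exact: (measurableT_comp mf (pair1_measurable x)).
have mgx (x : V) : measurable_fun [set: V] (fun y => (slob_kernel g x y)%:E).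
  exact: (measurableT_comp mg (pair1_measurable x)).
have k0 f' x y : (0 <= (slob_kernel f' x y)%:E)%E.
  by rewrite lee_fin slob_kernel_ge0.
have z0 : 0 <= 2 * sqmod z by rewrite mulr_ge0 ?sqmod_ge0.
apply: (@le_lt_trans _ _ ((2 * sqmod z)%:E * slobodeckij Om f +
                          2%:E * slobodeckij Om g)%E); last first.
  by apply: lte_add_pinfty; apply: lte_mul_pinfty; rewrite ?lee_fin.
have i0 f' (x : V) : (0 <= \int[mu]_y (slob_kernel f' x y)%:E)%E.
  by apply: integral_ge0 => y _.
have mFf : measurable_fun [set: V]
    (fun x => \int[mu]_y (slob_kernel f x y)%:E)%E.
  by apply: (sigma_finite_measurable_section sfin mf) => ?; exact: k0.
have mFg : measurable_fun [set: V]
    (fun x => \int[mu]_y (slob_kernel g x y)%:E)%E.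
  by apply: (sigma_finite_measurable_section sfin mg) => ?; exact: k0.
have mf0 : measurable_fun [set: V]
    (fun x => (2 * sqmod z)%:E * \int[mu]_y (slob_kernel f x y)%:E)%E.
  exact: (measurable_funeM _ mFf).
have mg0 : measurable_fun [set: V]
    (fun x => 2%:E * \int[mu]_y (slob_kernel g x y)%:E)%E.
  exact: (measurable_funeM _ mFg).
have -> : ((2 * sqmod z)%:E * slobodeckij Om f + 2%:E * slobodeckij Om g =
  \int[mu]_x ((2 * sqmod z)%:E * (\int[mu]_y (slob_kernel f x y)%:E) +
              2%:E * (\int[mu]_y (slob_kernel g x y)%:E)))%E.
  rewrite (ge0_integralD mu measurableT _ mf0 _ mg0); last 2 first.
  - by move=> x _; apply: mule_ge0; [rewrite lee_fin|exact: i0].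
  - by move=> x _; apply: mule_ge0; [rewrite lee_fin|exact: i0].
  rewrite (ge0_integralZl mu measurableT mFf); last 2 first.
  - by move=> x _; exact: i0.
  - by rewrite lee_fin.
  rewrite (ge0_integralZl mu measurableT mFg); last 2 first.
  - by move=> x _; exact: i0.
  - by rewrite lee_fin.
  by [].
apply: ge0_integral_mono => x; first exact: i0.
have mfx0 : measurable_fun [set: V]
    (fun y => (2 * sqmod z)%:E * (slob_kernel f x y)%:E)%E.
  exact: (measurable_funeM _ (mfx x)).
have mgx0 : measurable_fun [set: V] (fun y => 2%:E * (slob_kernel g x y)%:E)%E.
  exact: (measurable_funeM _ (mgx x)).
rewrite -(ge0_integralZl mu measurableT (mfx x)); last 2 first.
- by move=> y _; exact: k0.
- by rewrite lee_fin.
rewrite -(ge0_integralZl mu measurableT (mgx x)); last 2 first.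
- by move=> y _; exact: k0.
- by rewrite lee_fin.
rewrite -(ge0_integralD mu measurableT _ mfx0 _ mgx0); last 2 first.
- by move=> y _; apply: mule_ge0; [rewrite lee_fin|exact: k0].
- by move=> y _; apply: mule_ge0; [rewrite lee_fin|exact: k0].
apply: ge0_integral_mono => y; first exact: (k0 (fun t => z * f t + g t)).
by rewrite -!EFinM -EFinD lee_fin; exact: slob_kernel_lin_le.
Qed.

End H12_linear.

(** * Riesz representation in H^1/2 and Green's identity for Robin subspaces *)

Section H12_geometry.
Context (R : realType) (n : nat).
Local Notation X := 'rV[R]_n.
Local Notation fn := (X -> R[i]).
Variable Om : set X.
Hypothesis bOm : bounded_set Om.
Local Notation mu := (surf Om).
Local Notation V := (caratheodory_type (surf_outer Om)).
Local Notation N := (L2_norm mu).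
Local Notation H := (H12 Om).
Variable ip : fn -> fn -> R[i].
Hypothesis ipP : H12_inner_product Om ip.
Variable Phi : (fn -> R[i]) -> fn.
Hypothesis PhiP : riesz_isomorphism Om ip Phi.
Implicit Types f g k : fn.

Lemma H12_L2 f : H f -> L2 mu f. Proof. by case. Qed.

Lemma slobodeckij_ge0 f : (0 <= slobodeckij Om f)%E.
Proof.
apply: integral_ge0 => x _; apply: integral_ge0 => y _.
exact: slob_kernel_ge0.
Qed.

Opaque H12 slobodeckij.

Lemma H12_Z z f : H f -> H (fun x => z * f x).
Proof.
(* z f = (z - 1) f + f, so that f is the only member of H^1/2 involved. *)
move=> Hf; have := H12_lin bOm (z - 1) Hf Hf.
by under eq_fun do rewrite mulrBl mul1r subrK.
Qed.

Lemma H12_N f : H f -> H (- f).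
Proof.
move=> Hf; have := H12_Z (-1) Hf; congr (H12 _ _); apply/funext => x.
by rewrite mulN1r.
Qed.

Lemma H12_D f g : H f -> H g -> H (f + g).
Proof.
move=> Hf Hg; have := H12_lin bOm 1 Hf Hg; congr (H12 _ _); apply/funext => x.
by rewrite mul1r.
Qed.

Lemma H12_B f g : H f -> H g -> H (f - g).
Proof. by move=> Hf Hg; apply: H12_D; [exact: Hf|exact: H12_N]. Qed.

Lemma ip_lin z f f' g : H f -> H f' -> H g ->
  ip (fun x => z * f x + f' x) g = z * ip f g + ip f' g.
Proof. by case: ipP => _ + _ _ _; exact. Qed.

Lemma ip_conj f g : H f -> H g -> ip g f = (ip f g)^*.
Proof. by case: ipP => _ _ + _ _; exact. Qed.

Lemma ip_ae f f' g g' : H f -> H f' -> H g -> H g' ->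
  ae_same mu f f' -> ae_same mu g g' -> ip f g = ip f' g'.
Proof. by case: ipP => + _ _ _ _; exact. Qed.

Lemma ip_Z z f g : H f -> H g -> ip (fun x => z * f x) g = z * ip f g.
Proof.
move=> Hf Hg; have := ip_lin (z - 1) Hf Hf Hg.
under eq_fun do rewrite mulrBl mul1r subrK.
by rewrite mulrBl mul1r subrK.
Qed.

Lemma ip_N f g : H f -> H g -> ip (- f) g = - ip f g.
Proof.
move=> Hf Hg; have := ip_Z (-1) Hf Hg; rewrite mulN1r => <-.
by congr (ip _ _); apply/funext => x; rewrite mulN1r.
Qed.

Lemma ip_D f f' g : H f -> H f' -> H g -> ip (f + f') g = ip f g + ip f' g.
Proof.
move=> Hf Hf' Hg; have := ip_lin 1 Hf Hf' Hg; rewrite mul1r => <-.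
by congr (ip _ _); apply/funext => x; rewrite mul1r.
Qed.

Lemma ip_Dr f g g' : H f -> H g -> H g' -> ip f (g + g') = ip f g + ip f g'.
Proof.
move=> Hf Hg Hg'; rewrite (ip_conj (H12_D Hg Hg') Hf) ip_D// conjD.
by rewrite (ip_conj Hg Hf) (ip_conj Hg' Hf).
Qed.

Lemma ip_Nr f g : H f -> H g -> ip f (- g) = - ip f g.
Proof.
move=> Hf Hg; rewrite (ip_conj (H12_N Hg) Hf) (ip_conj Hg Hf) ip_N//.
by apply: complex_eq; rewrite !reimE.
Qed.

Lemma ip_Zr (c : R) f g : H f -> H g ->
  ip f (fun x => c%:C * g x) = c%:C * ip f g.
Proof.
move=> Hf Hg; rewrite (ip_conj (H12_Z _ Hg) Hf) (ip_conj Hg Hf) ip_Z//.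
by apply: complex_eq; rewrite !reimE /=; ring.
Qed.

Lemma ip_0r f : H f -> ip f 0 = 0.
Proof.
move=> Hf; have H0 := H12_B Hf Hf; rewrite -(subrr f).
by rewrite (ip_Dr Hf Hf (H12_N Hf)) (ip_Nr Hf Hf) subrr.
Qed.

Lemma ip_ge0 f : H f -> 0 <= Re (ip f f).
Proof.
case: ipP => _ _ _ + _ => /(_ f) ip0 /ip0.
by rewrite lecE /= => /andP[].
Qed.

Lemma L2_norm_le_H12 f : N f <= H12_norm Om f.
Proof.
rewrite -[N f]ger0_norm ?L2_norm_ge0// -sqrtr_sqr ler_wsqrtr// lerDl fine_ge0//.
exact: slobodeckij_ge0.
Qed.

Lemma L2_norm_le_ip : exists2 c, 0 <= c &
  forall f, H f -> N f <= c * Num.sqrt (Re (ip f f)).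
Proof.
have [_ _ _ _ [c1 [c2 [c10 _ eqv]]]] := ipP.
exists (Num.sqrt c1^-1); first exact: sqrtr_ge0.
move=> f Hf; have /andP[h _] := eqv f Hf.
have key : N f ^+ 2 <= c1^-1 * Re (ip f f).
  rewrite mulrC ler_pdivlMr//; apply: le_trans h.
  rewrite mulrC ler_pM2l// ler_pXn2r ?nnegrE ?L2_norm_ge0//.
    exact: L2_norm_le_H12.
  exact: sqrtr_ge0.
rewrite -sqrtrM; last by rewrite invr_ge0 ltW.
rewrite -[leLHS]ger0_norm; last exact: L2_norm_ge0.
by rewrite -sqrtr_sqr; exact: ler_wsqrtr.
Qed.

(** Testing with g - g' gives zero for its square; norm equivalence then makes its L^2 norm
    vanish. *)
Lemma riesz_unique g g' : H g -> H g' -> (forall f, H f -> ip f g = ip f g') ->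
  ae_same mu g g'.
Proof.
move=> Hg Hg' gg'; have Hd := H12_B Hg Hg'.
have d0 : ip (g - g') (g - g') = 0.
  by rewrite (ip_Dr Hd Hg (H12_N Hg')) (ip_Nr Hd Hg') (gg' _ Hd) subrr.
have [c _ cP] := L2_norm_le_ip; have := cP _ Hd.
rewrite d0 /= sqrtr0 mulr0 => N0.
have /(L2_norm_eq0 (H12_L2 Hd)) : N (g - g') = 0.
  by apply/eqP; rewrite eq_le N0 L2_norm_ge0.
by apply: aeS => x /eqP; rewrite subr_eq0 => /eqP.
Qed.

Lemma Phi_unique psi g : Hm12 Om psi -> H g ->
  (forall f, H f -> psi f = ip f g) -> ae_same mu (Phi psi) g.
Proof.
move=> hpsi Hg psig; have [HPhi PhiE] := PhiP hpsi.
by apply: riesz_unique => // f Hf; rewrite -PhiE// psig.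
Qed.

(** [Phi] acts on representatives of functionals; its values are determined, up to null sets, by the
    functional on H^1/2. *)
Lemma Phi_same psi psi' : Hm12 Om psi -> Hm12 Om psi' ->
  Hm12_same Om psi psi' ->
  ae_same mu (Phi psi) (Phi psi').
Proof.
move=> hpsi hpsi' same; have [HPhi PhiE] := PhiP hpsi'.
by apply: Phi_unique => // f Hf; rewrite -PhiE// same.
Qed.

Lemma iota_star_Hm12 g : L2 mu g -> Hm12 Om (iota_star Om g).
Proof.
move=> Lg; split.
- move=> f f' /H12_L2 Lf /H12_L2 Lf' ff'; apply: L2_ip_ae => //.
  by apply: aeS ff'.
- by move=> z f f' /H12_L2 Lf /H12_L2 Lf'; exact: L2_ip_lin.
- exists (2 * N g) => f /H12_L2 Lf; apply: le_trans (L2_cmod_ip Lf Lg) _.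
  rewrite -mulrA ler_wpM2l// mulrC ler_wpM2l ?L2_norm_ge0//.
  exact: L2_norm_le_H12.
Qed.

Definition bounded_multiplier (h : X -> R) : Prop :=
  measurable_fun [set: V] h /\
  exists2 r, 0 <= r & {ae mu, forall x, `|h x| <= r}.

Lemma bounded_multiplier_L2 h f : bounded_multiplier h -> L2 mu f ->
  L2 mu (fun x => (h x)%:C * f x).
Proof. by move=> [mh [r r0 hr]] Lf; have [] := L2_mulr mh r0 hr Lf. Qed.

(** The second component of the point of the Robin subspace with multiplier h and first component
    f. *)
Definition robin_vector (h : X -> R) f : fn :=
  - Phi (iota_star Om (fun x => (h x)%:C * f x)).

Lemma robin_vectorP h f : bounded_multiplier h -> H f ->
  H (robin_vector h f) /\ forall k, H k ->
  ip k (robin_vector h f) = - L2_ip mu k (fun x => (h x)%:C * f x).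
Proof.
move=> bh Hf.
have hm := iota_star_Hm12 (bounded_multiplier_L2 bh (H12_L2 Hf)).
have [HPhi PhiE] := PhiP hm; split; first exact: H12_N.
by move=> k Hk; rewrite (ip_Nr Hk HPhi) -(PhiE k Hk).
Qed.

Lemma robin_vectorZ (c : R) h f : bounded_multiplier h -> H f ->
  ae_same mu (robin_vector h (fun x => c%:C * f x))
             (fun x => c%:C * robin_vector h f x).
Proof.
move=> bh Hf; have Hcf := H12_Z c%:C Hf.
have [Hr rE] := robin_vectorP bh Hf; have [Hcr crE] := robin_vectorP bh Hcf.
apply: (riesz_unique Hcr (H12_Z _ Hr)) => k Hk.
rewrite (crE k Hk) (ip_Zr c Hk Hr) (rE k Hk) mulrN; congr (- _).
have Lk := H12_L2 Hk; have Lhf := bounded_multiplier_L2 bh (H12_L2 Hf).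
rewrite (_ : (fun x => _) = (fun x => c%:C * ((h x)%:C * f x))); last first.
  by apply/funext => x; ring.
rewrite (L2_ip_conj (L2_Z c%:C Lhf) Lk) (L2_ip_conj Lhf Lk) (L2_ip_Z1 _ Lhf Lk).
by apply: complex_eq; rewrite !reimE /=; ring.
Qed.

(* Green's identity for two points p and p + m of the Robin subspaces for h0 *)
(* and h1: only the difference of the multipliers survives.                  *)
Lemma omega_robin (h0 h1 : X -> R) f p2 m1 m2 g :
  bounded_multiplier h0 -> bounded_multiplier h1 ->
  H f -> H p2 -> H m1 -> H m2 -> H g ->
  (forall k, H k -> ip k p2 = - L2_ip mu k (fun x => (h0 x)%:C * f x)) ->
  ae_same mu (f + m1) g -> ae_same mu (p2 + m2) (robin_vector h1 g) ->
  omega ip (f, p2) (m1, m2) =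
  L2_ip mu f (fun x => (h1 x - h0 x)%:C * (f x + m1 x)).
Proof.
move=> b0 b1 Hf Hp2 Hm1 Hm2 Hg p2E fg rE.
have [Lf Lm1 Lg] := And3 (H12_L2 Hf) (H12_L2 Hm1) (H12_L2 Hg).
have Lfm := L2_D Lf Lm1.
have L0f := bounded_multiplier_L2 b0 Lf.
have L0m := bounded_multiplier_L2 b0 Lm1.
have L1g := bounded_multiplier_L2 b1 Lg.
have L1f := bounded_multiplier_L2 b1 Lfm.
rewrite /omega /HH_ip /J /= (ip_N Hf Hm2).
(* The multiplier is real, so it moves across the L^2 pairing; this symmetry makes the [h0] terms
   combine. *)
have -> : ip p2 m1 = - L2_ip mu f (fun x => (h0 x)%:C * m1 x).
  have -> : L2_ip mu f (fun x => (h0 x)%:C * m1 x) =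
            (L2_ip mu m1 (fun x => (h0 x)%:C * f x))^*.
    by rewrite -L2_ip_mulr; exact: L2_ip_conj.
  rewrite (ip_conj Hm1 Hp2) (p2E _ Hm1).
  by apply: complex_eq; rewrite !reimE.
(* The Robin condition for [h1] gives the pairing with p2 + m2; the one for [h0] is subtracted. *)
have -> : ip f m2 = - L2_ip mu f (fun x => (h1 x)%:C * (f x + m1 x)) +
                    L2_ip mu f (fun x => (h0 x)%:C * f x).
  have [Hr rP] := robin_vectorP b1 Hg.
  have := ip_Dr Hf Hp2 Hm2.
  rewrite (ip_ae Hf Hf (H12_D Hp2 Hm2) Hr _ rE); last by apply: aeS rE.
  rewrite (rP _ Hf) (p2E _ Hf).
  have -> : L2_ip mu f (fun x => (h1 x)%:C * g x) =
            L2_ip mu f (fun x => (h1 x)%:C * (f x + m1 x)).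
    apply: (L2_ip_ae Lf Lf L1g L1f); first by apply: aeS fg.
    by apply: aeS fg => x <-.
  by move=> ->; rewrite addrAC addNr add0r.
rewrite (_ : (fun x => (h1 x - h0 x)%:C * _) = (fun x =>
    (h1 x)%:C * (f x + m1 x) + - ((h0 x)%:C * f x + (h0 x)%:C * m1 x)));
  last first.
  by apply/funext => x; apply: complex_eq; rewrite !reimE /=; ring.
have LD := L2_D L0f L0m.
rewrite (L2_ip_D2 Lf L1f (L2_N LD)).
rewrite (_ : L2_ip mu f (fun x => - _) =
    - L2_ip mu f (fun x => (h0 x)%:C * f x + (h0 x)%:C * m1 x)).
  by rewrite (L2_ip_D2 Lf L0f L0m); ring.
under [in LHS]eq_fun do rewrite -mulN1r.
rewrite (L2_ip_conj (L2_Z _ LD) Lf) (L2_ip_Z1 _ LD Lf) (L2_ip_conj LD Lf).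
by apply: complex_eq; rewrite !reimE /=; ring.
Qed.

End H12_geometry.

(** * Weak solutions *)

Section complex_limits.
Context (R : realType).

Lemma cvg_dominated (T : Type) (F : set_system T) (f e : T -> R) (l : R) :
  Filter F -> (\forall x \near F, `|f x - l| <= e x) ->
  e x @[x --> F] --> 0 -> f x @[x --> F] --> l.
Proof.
move=> FF fe e0; apply/subr_cvg0.
apply: (squeeze_cvgr (f := fun x => - e x) _ _ e0).
  by apply: filterS fe => x; rewrite ler_norml.
by rewrite -oppr0; exact: cvgN.
Qed.

Definition ccvg (z_ : nat -> R[i]) (z : R[i]) : Prop :=
  (Re (z_ k) @[k --> \oo] --> Re z) /\ (Im (z_ k) @[k --> \oo] --> Im z).

Lemma ccvgD (y_ z_ : nat -> R[i]) y z : ccvg y_ y -> ccvg z_ z ->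
  ccvg (fun k => y_ k + z_ k) (y + z).
Proof.
move=> [yr yi] [zr zi]; split.
  by rewrite ReD; under eq_fun do rewrite ReD; exact: cvgD.
by rewrite ImD; under eq_fun do rewrite ImD; exact: cvgD.
Qed.

Lemma ccvg_cst z : ccvg (fun=> z) z.
Proof. by split; exact: cvg_cst. Qed.

Lemma ccvg_sum (I : Type) (r : seq I) (z_ : I -> nat -> R[i]) (z : I -> R[i]) :
  (forall i, ccvg (z_ i) (z i)) ->
  ccvg (fun k => \sum_(i <- r) z_ i k) (\sum_(i <- r) z i).
Proof.
move=> h; elim: r => [|i r IH].
  by under eq_fun do rewrite big_nil; rewrite big_nil; exact: ccvg_cst.
by under eq_fun do rewrite big_cons; rewrite big_cons; exact: ccvgD.
Qed.

Lemma ccvg_unique (z_ : nat -> R[i]) y z : ccvg z_ y -> ccvg z_ z -> y = z.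
Proof.
by move=> [yr yi] [zr zi]; apply: complex_eq;
  [exact: cvg_unique yr zr|exact: cvg_unique yi zi].
Qed.

Lemma L2_cvg_ip d (T : measurableType d) (mu : {measure set T -> \bar R})
    (v : T -> R[i]) (f_ : nat -> T -> R[i]) f :
  L2 mu v -> L2_cvg mu f_ f -> ccvg (fun k => L2_ip mu v (f_ k)) (L2_ip mu v f).
Proof.
move=> Lv [Lf_ Lf f_f].
have ipB k : L2_ip mu v (f_ k) - L2_ip mu v f =
    L2_ip mu v (fun x => f_ k x - f x).
  have := L2_ip_D2 Lv (L2_B (Lf_ k) Lf) Lf.
  under [in LHS]eq_fun do rewrite subrK.
  by move=> ->; rewrite addrK.
have to0 : L2_norm mu v * L2_norm mu (fun x => f_ k x - f x) @[k --> \oo] --> 0.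
  by rewrite -[X in _ --> X](mulr0 (L2_norm mu v)); apply: cvgMr.
split.
- apply: cvg_dominated to0; apply: nearW => k.
  by rewrite -ReN -ReD ipB; exact: (L2_CauchySchwarz_Re Lv (L2_B (Lf_ k) Lf)).
- apply: cvg_dominated to0; apply: nearW => k.
  by rewrite -ImN -ImD ipB; exact: (L2_CauchySchwarz_Im Lv (L2_B (Lf_ k) Lf)).
Qed.

End complex_limits.

Section weak_solutions.
Context (R : realType) (n : nat).
Local Notation X := 'rV[R]_n.
Local Notation fn := (X -> R[i]).
Variable Om : set X.
Hypothesis bOm : bounded_set Om.
Local Notation mu := (vol Om).
Local Notation ip := (L2_ip mu).
Implicit Types u v f : fn.

Lemma vol_ae (P : set X) : (forall x, Om x -> P x) -> {ae mu, forall x, P x}.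
Proof. exact: outer_restr_ae. Qed.

(** The bounded measurable extension is an L^2 multiplier, and it agrees with h on [Om], which
    carries the whole measure. *)
Lemma smooth_closure_L2 (h : X -> R) u : smooth_closure Om h -> L2 mu u ->
  L2 mu (fun x => (h x)%:C * u x).
Proof.
move=> sh Lu; have [g [mg hg [C gC]]] := smooth_closure_bounded bOm sh.
have cl x : Om x -> closure Om x by exact: subset_closure.
have gb : {ae mu, forall x, `|g x| <= Num.max 0 C}.
  by apply: vol_ae => x /cl/gC gx; rewrite le_max gx orbT.
have C0 : 0 <= Num.max 0 C by rewrite le_max lexx.
have [Lg _] := L2_mulr mg C0 gb Lu.
apply: (L2_complete _ Lg); first exact: measure_is_complete_caratheodory.
by apply: vol_ae => x /cl/hg ->.
Qed.

Lemma wpd_L2 i u : H1 Om u -> L2 mu (wpd Om i u).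
Proof.
move=> [_ /(_ i)[g Lg wg]].
have : exists g, [set g | L2 mu g /\ weak_pd Om i u g] g by exists g.
by case/(xgetPex (fun=> 0)).
Qed.

Context (a : 'I_n -> 'I_n -> X -> R) (b : 'I_n -> X -> R) (q : X -> R).
Hypothesis coefs : elliptic_coefficients Om a b q.

Lemma calL_form_shift (lam : R) u phi dphi : L2 mu u -> L2 mu phi ->
  calL_form Om a b q lam u phi dphi =
  calL_form Om a b q 0 u phi dphi - lam%:C * ip u phi.
Proof.
move=> Lu Lphi; have [_ _ _ Lq _] := coefs.
have [mq [r r0 qr]] := Linfty_ae Lq; have [Lqu _] := L2_mulr mq r0 qr Lu.
rewrite /calL_form -[RHS]addrA; congr (_ + _).
have E (c : R) : ip (fun x => (q x)%:C * u x - c%:C * u x) phi =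
    ip (fun x => (q x)%:C * u x) phi - c%:C * ip u phi.
  have := L2_ip_D1 Lqu (L2_N (L2_Z c%:C Lu)) Lphi => ->; congr (_ + _).
  have := L2_ip_Z1 (- c%:C) Lu Lphi; rewrite mulNr => <-.
  by under [in RHS]eq_fun do rewrite mulNr.
by rewrite (E lam) (E 0) (_ : 0%:C = 0)// mul0r subr0.
Qed.

(** For fixed u in H^1 every term pairs a fixed L^2 function with [phi] or a component of [dphi], so
    Cauchy-Schwarz gives continuity. Real coefficients are first moved onto u. *)
Lemma calL_form_cvg (lam : R) u phi (phi_ : nat -> fn) dphi dphi_ :
  H1 Om u -> L2_cvg mu phi_ phi ->
  (forall i, L2_cvg mu (fun k => dphi_ k i) (dphi i)) ->
  ccvg (fun k => calL_form Om a b q lam u (phi_ k) (dphi_ k))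
       (calL_form Om a b q lam u phi dphi).
Proof.
move=> Hu cphi cdphi; have [_ sa sb Lq _] := coefs.
have [Lu _] := Hu.
have [mq [r r0 qr]] := Linfty_ae Lq; have [Lqu _] := L2_mulr mq r0 qr Lu.
apply: ccvgD; last first.
  by apply: L2_cvg_ip cphi; exact: (L2_B Lqu (L2_Z _ Lu)).
apply: ccvgD; last first.
  apply: ccvg_sum => j; rewrite -L2_ip_mulr.
  under eq_fun do rewrite -L2_ip_mulr.
  by apply: L2_cvg_ip; [exact: smooth_closure_L2|exact: cdphi].
apply: ccvgD.
  apply: ccvg_sum => j; apply: ccvg_sum => k.
  exact: (L2_cvg_ip (smooth_closure_L2 (sa j k) (wpd_L2 k Hu)) (cdphi j)).
apply: ccvg_sum => j.
exact: (L2_cvg_ip (smooth_closure_L2 (sb j) (wpd_L2 j Hu)) cphi).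
Qed.

(** H^1_0 consists of H^1-limits of test functions. Along such a sequence the form of calL - lam
    vanishes identically, and by continuity it converges to its value at [phi]. *)
Lemma eigenfunction_weak_solution (lam : R) u : D1 Om a b q u ->
  ae_same mu (calL Om a b q u) (fun x => lam%:C * u x) ->
  weak_solutions Om a b q lam u.
Proof.
move=> [Hu exf] Lae; split; first exact: Hu.
move=> phi [Hphi [phi_ tphi [cphi cdphi]]].
have [Lu _] := Hu.
have [LL LE] : calL_eq Om a b q u (calL Om a b q u) by exact: xgetPex.
apply: (@ccvg_unique _ (fun k =>
    calL_form Om a b q lam u (phi_ k) (fun j => pdC j (phi_ k)))).
  exact: calL_form_cvg.
have [Lphi_ _ _] := cphi.
rewrite (_ : (fun k => _) = fun=> 0); first exact: ccvg_cst.
apply/funext => k; rewrite (calL_form_shift lam _ Lu (Lphi_ k)) (LE _ (tphi k)).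
rewrite (L2_ip_ae LL (L2_Z lam%:C Lu) (Lphi_ k) (Lphi_ k) Lae); last first.
  by apply: vol_ae.
by rewrite (L2_ip_Z1 lam%:C Lu (Lphi_ k)) subrr.
Qed.

End weak_solutions.

(** * The crossing form *)

Section difference_quotients.
Context d (T : measurableType d) (R : realType).
Variable mu : {measure set T -> \bar R}.
Local Notation N := (L2_norm mu).
Local Notation ip := (L2_ip mu).

(** Expand (h1 - h0)(f + m) = s (dh f + r), with r = ((h1 - h0)/s - dh)(f + m) + dh m. The error z
    is the pairing of f with r, bounded by Cauchy-Schwarz. *)
Lemma multiplier_quotient (h0 h1 dh : T -> R) (s e C : R) (f m : T -> R[i]) :
  measurable_fun [set: T] h0 -> measurable_fun [set: T] h1 ->
  measurable_fun [set: T] dh -> s != 0 -> 0 <= e -> 0 <= C ->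
  {ae mu, forall x, `|(h1 x - h0 x) / s - dh x| <= e} ->
  {ae mu, forall x, `|dh x| <= C} ->
  L2 mu f -> L2 mu m ->
  exists z : R[i], [/\
    ip f (fun x => (h1 x - h0 x)%:C * (f x + m x)) =
      s%:C * (ip (fun x => (dh x)%:C * f x) f + z),
    `|Re z| <= N f * (e * (N f + N m) + C * N m) &
    `|Im z| <= N f * (e * (N f + N m) + C * N m)].
Proof.
move=> mh0 mh1 mdh s0 e0 C0 ae_e ae_C Lf Lm.
have Lfm := L2_D Lf Lm.
have mD : measurable_fun [set: T] (fun x => (h1 x - h0 x) / s - dh x).
  apply: measurable_funB => //; apply: measurable_funM => //.
  exact: measurable_funB.
have [L1 N1] := L2_mulr mD e0 ae_e Lfm.
have [L2m N2] := L2_mulr mdh C0 ae_C Lm.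
have [L2f _] := L2_mulr mdh C0 ae_C Lf.
have L12 := L2_D L1 L2m.
have bound : N (fun x => ((h1 x - h0 x) / s - dh x)%:C * (f x + m x) +
    (dh x)%:C * m x) <= e * (N f + N m) + C * N m.
  apply: le_trans (L2_norm_triangle L1 L2m) _; apply: lerD => //.
  by apply: le_trans N1 _; rewrite ler_wpM2l//; exact: L2_norm_triangle.
exists (ip f (fun x => ((h1 x - h0 x) / s - dh x)%:C * (f x + m x) +
    (dh x)%:C * m x)); split; last 2 first.
- apply: le_trans (L2_CauchySchwarz_Re Lf L12) _.
  by rewrite ler_wpM2l// L2_norm_ge0.
- apply: le_trans (L2_CauchySchwarz_Im Lf L12) _.
  by rewrite ler_wpM2l// L2_norm_ge0.
rewrite L2_ip_mulr -(L2_ip_D2 Lf L2f L12).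
rewrite (L2_ip_conj (L2_D L2f L12) Lf).
rewrite (_ : (fun x => (h1 x - h0 x)%:C * _) = (fun x => s%:C *
  ((dh x)%:C * f x + (((h1 x - h0 x) / s - dh x)%:C * (f x + m x) +
    (dh x)%:C * m x)))); last first.
  apply/funext => x; apply: complex_eq; rewrite !reimE /=; field; exact: s0.
rewrite (L2_ip_conj (L2_Z _ (L2_D L2f L12)) Lf).
rewrite (L2_ip_Z1 _ (L2_D L2f L12) Lf).
by apply: complex_eq; rewrite !reimE /=; ring.
Qed.

End difference_quotients.

(** * Smallness of the graph operators near the crossing *)

Section graph_maps.
Context (R : realType) (n : nat).
Local Notation X := 'rV[R]_n.
Local Notation fn := (X -> R[i]).
Variable Om : set X.
Hypothesis bOm : bounded_set Om.
Local Notation mu := (surf Om).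
Local Notation N := (L2_norm mu).
Local Notation H := (H12 Om).
Variable ip : fn -> fn -> R[i].
Hypothesis ipP : H12_inner_product Om ip.

Opaque H12 slobodeckij.

Lemma HH_normZ (c : R) p : 0 <= c -> HH Om p ->
  HH_norm ip (HH_scale c%:C p) = c * HH_norm ip p.
Proof.
move=> c0 [H1 H2]; rewrite /HH_norm -[c in RHS]ger0_norm// -[in RHS]sqrtr_sqr.
rewrite -sqrtrM ?sqr_ge0//; congr Num.sqrt; rewrite /HH_ip /HH_scale /=.
rewrite (ip_Z ipP _ H1 (H12_Z bOm c%:C H1)) (ip_Zr bOm ipP c H1 H1).
rewrite (ip_Z ipP _ H2 (H12_Z bOm c%:C H2)) (ip_Zr bOm ipP c H2 H2).
by rewrite !reimE /=; ring.
Qed.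

Lemma L2_norm_le_HH : exists2 K, 0 <= K &
  forall p, HH Om p -> N p.1 <= K * HH_norm ip p.
Proof.
have [K K0 KP] := L2_norm_le_ip ipP; exists K => // p [H1 H2].
apply: le_trans (KP _ H1) _; apply: ler_wpM2l => //; apply: ler_wsqrtr.
by rewrite /HH_ip ReD lerDl; exact: (ip_ge0 ipP H2).
Qed.

(** Since M vanishes at [t0], M_t p is (t - t0) times the derivative plus an error small in operator
    norm. The H^1/2 norm controls the L^2 norm of the first component. *)
Lemma graph_map_small (I : set R) (E E' : set (fn * fn)) M dM (t0 : R) p :
  (forall q, E' q -> HH Om q) -> E p -> (forall c : R, E (HH_scale c%:C p)) ->
  HH Om p -> I t0 -> C1_operators Om ip I E E' M dM ->
  (forall q, E q -> HH_same Om (M t0 q) 0) ->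
  exists2 B : R -> R, \forall t \near within I t0^', N (M t p).1 <= B t &
    B t @[t --> within I t0^'] --> 0.
Proof.
move=> E'H Ep EZ HHp It0 MC1 Mt0.
have [K K0 KP] := L2_norm_le_HH.
(* [op_norm] sees only the unit ball, so p is rescaled into it; the 1 avoids dividing by a zero
   norm. *)
pose c : R := (1 + HH_norm ip p)^-1.
have p1 : 0 < 1 + HH_norm ip p by rewrite ltr_pwDl// sqrtr_ge0.
have c0 : 0 < c by rewrite invr_gt0.
pose p' := HH_scale c%:C p.
have Ep' : E p' := EZ c.
have p'1 : HH_norm ip p' <= 1.
  rewrite (HH_normZ (ltW c0) HHp) mulrC ler_pdivrMr// mul1r.
  by rewrite lerDr.
have [[Mt0E _ _] [dME _ _] cvgA _] := MC1 _ It0.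
pose A (t : R) := fun q => HH_scale ((t - t0)^-1)%:C (M t q - M t0 q) - dM t0 q.
pose a t := fine (op_norm ip E (A t)).
have [afin a0] :
    (\forall t \near within I t0^', op_norm ip E (A t) \is a fin_num) /\
    a t @[t --> within I t0^'] --> 0 by exact/fine_cvgP.
pose D := N (dM t0 p').1.
pose B t := c^-1 * (`|t - t0| * (K * a t + D)).
exists B.
  have nI : \forall t \near within I t0^', I t /\ t != t0.
    by rewrite near_withinE; apply: filterS (nbhs_dnbhs_neq t0) => t.
  apply: filterS2 afin nI => t tfin [It tt0].
  have [[MtE MtL _] _ _ _] := MC1 _ It.
  have HMt q : E q -> HH Om (M t q) by move=> /MtE /E'H.
  have HM0 q : E q -> HH Om (M t0 q) by move=> /Mt0E /E'H.
  have HdM q : E q -> HH Om (dM t0 q) by move=> /dME /E'H.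
  have [HM1 HM2] := HMt _ Ep'; have [HM01 HM02] := HM0 _ Ep'.
  have [Hd1 Hd2] := HdM _ Ep'.
  have HA : HH Om (A t p').
    split; first exact: (H12_B bOm (H12_Z bOm _ (H12_B bOm HM1 HM01)) Hd1).
    exact: (H12_B bOm (H12_Z bOm _ (H12_B bOm HM2 HM02)) Hd2).
  have NA : N (A t p').1 <= K * a t.
    apply: le_trans (KP _ HA) _; apply: ler_wpM2l => //.
    rewrite -lee_fin /a fineK//; apply: ereal_sup_ubound.
    by exists p'.
  have Mp' : N (M t p').1 = c * N (M t p).1.
    have [HMp _] := HMt _ Ep.
    (* Linearity is stated for z p + q, hence c p is written as (c - 1) p + p. *)
    have := MtL (c - 1)%:C p p Ep Ep.
    rewrite (_ : HH_scale _ p + p = p'); last first.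
      by congr pair; apply/funext => x; apply: complex_eq;
        rewrite /HH_scale/= !reimE/=; ring.
    move=> [same _].
    rewrite (_ : (_ + _).1 = (fun x => c%:C * (M t p).1 x)) in same; last first.
      by apply/funext => x; apply: complex_eq;
        rewrite /HH_scale/= !reimE/=; ring.
    rewrite (L2_norm_ae (H12_L2 HM1) (L2_Z _ (H12_L2 HMp)) same).
    rewrite (L2_normZ _ (H12_L2 HMp)); congr (_ * _).
    by rewrite /cmod sqmod_real sqrtr_sqr ger0_norm// ltW.
  have LA := H12_L2 HA.1; have Ld := H12_L2 Hd1.
  have eqM : ae_same mu (M t p').1
      (fun x => (t - t0)%:C * ((A t p').1 x + (dM t0 p').1 x)).
    have [M0 _] := Mt0 _ Ep'; apply: aeS M0 => x M0x.
    have -> : (A t p').1 x = ((t - t0)^-1)%:C * ((M t p').1 x - (M t0 p').1 x)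
      - (dM t0 p').1 x by [].
    rewrite M0x; apply: complex_eq; rewrite !reimE /=.
      by field; rewrite subr_eq0.
    by field; rewrite subr_eq0.
  rewrite /B ler_pdivlMl// -Mp'.
  rewrite (L2_norm_ae (H12_L2 HM1) (L2_Z _ (L2_D LA Ld)) eqM).
  rewrite (L2_normZ _ (L2_D LA Ld)) /cmod sqmod_real sqrtr_sqr.
  rewrite ler_wpM2l//; apply: le_trans (L2_norm_triangle LA Ld) _.
  exact: lerD.
have ct0 : t @[t --> within I t0^'] --> t0.
  by apply: cvg_within_filter; exact: nbhs_dnbhs.
rewrite (_ : 0 = c^-1 * (`|t0 - t0| * (K * 0 + D))); last first.
  by rewrite subrr normr0 mul0r mulr0.
apply: cvgMr; apply: cvgM.
  by apply: cvg_norm; apply: cvgB => //; exact: cvg_cst.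
by apply: cvgD; [exact: cvgMr|exact: cvg_cst].
Qed.

End graph_maps.

(** This makes limits within I unique, including the one-sided limits at 0 and 1. *)
Lemma unit_interval_dnbhs_proper (R : realType) (t0 delta : R) :
  0 <= t0 <= 1 -> 0 < delta ->
  ProperFilter (within [set t : R | 0 <= t <= 1 /\ `|t - t0| < delta] t0^').
Proof.
move=> t01 d0; apply: Build_ProperFilter_ex => A.
rewrite /within /= => /nbhs_ballP[e /= e0 eA].
(* s is at most 1/2, so stepping from t0 towards the far end of [0,1] stays inside. *)
pose s := Num.min (Num.min e delta) 1 / 2.
have m0 : 0 < Num.min (Num.min e delta) 1 by rewrite !lt_min e0 d0 ltr01.
have [me md m1] : [/\ Num.min (Num.min e delta) 1 <= e,
    Num.min (Num.min e delta) 1 <= delta & Num.min (Num.min e delta) 1 <= 1].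
  by rewrite !ge_min !lexx !orbT.
have s0 : 0 < s by rewrite divr_gt0.
have [se sd s12] : [/\ s < e, s < delta & s <= 1 / 2] by rewrite /s; split; lra.
have [le|ge] := leP t0 (1 / 2).
  exists (t0 + s); apply: eA => /=.
  - by rewrite /ball /= opprD addrA subrr add0r normrN gtr0_norm.
  - by rewrite gt_eqF// ltrDl.
  - by rewrite (addrC t0) addrK gtr0_norm//; split => //; move/andP: t01; lra.
exists (t0 - s); apply: eA => /=.
- by rewrite /ball /= opprB addrC subrK gtr0_norm.
- by rewrite lt_eqF// ltrBlDr ltrDl.
- rewrite addrAC subrr add0r normrN gtr0_norm//; split => //.
  by move/andP: t01; lra.
Qed.

Opaque H12 slobodeckij.

Theorem proposition5p8 (R : realType) (n : nat) (n_gt0 : (0 < n)%N)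
    (Om : set 'rV[R]_n) (Om_dom : smooth_bounded_domain Om)
    (a : 'I_n -> 'I_n -> 'rV[R]_n -> R) (b : 'I_n -> 'rV[R]_n -> R)
    (q : 'rV[R]_n -> R) (coefs : elliptic_coefficients Om a b q)
    (ip : ('rV[R]_n -> R[i]) -> ('rV[R]_n -> R[i]) -> R[i])
    (ipP : H12_inner_product Om ip)
    (gD : ('rV[R]_n -> R[i]) -> 'rV[R]_n -> R[i])
    (gDP : dirichlet_trace Om gD)
    (gN : ('rV[R]_n -> R[i]) -> ('rV[R]_n -> R[i]) -> R[i])
    (gNP : conormal_derivative Om a b q gD gN)
    (Phi : (('rV[R]_n -> R[i]) -> R[i]) -> 'rV[R]_n -> R[i])
    (PhiP : riesz_isomorphism Om ip Phi)
    (Theta dTheta : R -> 'rV[R]_n -> R)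
    (ThetaC1 : C1_Linfty (surf Om) [set t : R | 0 <= t <= 1] Theta dTheta)
    (t0 : R) (t0_01 : 0 <= t0 <= 1)
    (lam0 : R) (m : nat) (m_ge1 : (1 <= m)%N)
    (lam0_isolated : exists e, isolating_radius (vol Om)
       (robin_domain Om a b q gD gN Theta t0) (calL Om a b q) lam0%:C e)
    (u : 'I_m -> 'rV[R]_n -> R[i])
    (u_basis : orthonormal_basis_of (vol Om)
       (eigenfunctions (vol Om) (robin_domain Om a b q gD gN Theta t0)
          (calL Om a b q) lam0%:C) u)
    (lam : 'I_m -> R -> R)
    (lamP : bifurcating_eigenvalues (vol Om)
       (robin_domain Om a b q gD gN Theta) (calL Om a b q)
       [set t : R | 0 <= t <= 1] t0 lam0 lam)
    (dlam : 'I_m -> R)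
    (lam_deriv : forall j,
       (lam j t - lam j t0) / (t - t0)
         @[t --> within [set t : R | 0 <= t <= 1] t0^'] --> dlam j)
    (dlamE : forall j, (dlam j)%:C =
       - L2_ip (surf Om) (fun x => (dTheta t0 x)%:C * gD (u j) x) (gD (u j)))
    (delta : R) (delta_gt0 : 0 < delta) (I : set R)
    (IE : I = [set t : R | 0 <= t <= 1 /\ `|t - t0| < delta])
    (M dM : R -> ('rV[R]_n -> R[i]) * ('rV[R]_n -> R[i]) ->
                 ('rV[R]_n -> R[i]) * ('rV[R]_n -> R[i]))
    (M_C1 : C1_operators Om ip I (calF Om Phi Theta t0)
       (orth_compl Om ip (calF Om Phi Theta t0)) M dM)
    (M_t0 : forall p, calF Om Phi Theta t0 p -> HH_same Om (M t0 p) 0)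
    (M_graph : forall t, I t -> calF Om Phi Theta t =
       [set p | exists2 r, calF Om Phi Theta t0 r & HH_same Om p (r + M t r)]) :
  forall j : 'I_m,
    let qj := (traceT Phi gD gN (u j), traceT Phi gD gN (u j)) in
    (osum (calK Om Phi a b q gD gN lam0) (calF Om Phi Theta t0)
       `&` diagonal_HH Om) qj /\
    (dlam j)%:C = maslov_form ip I t0 M qj qj.

Proof.
have [_ _ _ bOm _] := Om_dom.
have mult t : 0 <= t <= 1 -> bounded_multiplier Om (Theta t) /\
    bounded_multiplier Om (dTheta t).
  by move=> /ThetaC1[/Linfty_ae hT /Linfty_ae hdT _ _].
have [bTh0 bdTh0] := mult _ t0_01.
have It0 : I t0 by rewrite IE /= subrr normr0.
have I01 t : I t -> 0 <= t <= 1 by rewrite IE => -[].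
have FI : ProperFilter (within I t0^').
  by rewrite IE; exact: unit_interval_dnbhs_proper.
move=> j; set p := traceT Phi gD gN (u j) => qj.
have [uE _ _] := u_basis; have [[D1u robu] eigu] := uE j.
have [H1u _] := D1u.
have [gDH12 _ _ _] := gDP; have [gNH _ _ _] := gNP.
set f := gD (u j).
have Hf : H12 Om f by exact: gDH12.
have hN : Hm12 Om (gN (u j)) by exact: gNH.
have Lf := H12_L2 Hf.
have hTh : Hm12 Om (iota_star Om (fun x => (Theta t0 x)%:C * f x)).
  by apply: iota_star_Hm12; exact: bounded_multiplier_L2.
have [HPhi PhiE] := PhiP _ hN.
have Hp2 : H12 Om p.2 by exact: H12_N.
have HHp : HH Om p := conj Hf Hp2.
(* The Robin condition on u, read through the Riesz isomorphism, in the form that [omega_robin]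
   takes. *)
have p2E k : H12 Om k ->
    ip k p.2 = - L2_ip (surf Om) k (fun x => (Theta t0 x)%:C * f x).
  by move=> Hk; rewrite (ip_Nr bOm ipP Hk HPhi) -(PhiE k Hk) (robu k Hk).
have p2r : ae_same (surf Om) p.2 (robin_vector Om Phi (Theta t0) f).
  by apply: aeS (Phi_same bOm ipP PhiP hN hTh robu) => x E; congr (- _).
have refl (g : 'rV[R]_n -> R[i]) : ae_same (surf Om) g g by exact: ae_same_refl.
have Fp : calF Om Phi Theta t0 p by exists f; [exact: Hf|split].
have FZ (c : R) : calF Om Phi Theta t0 (HH_scale c%:C p).
  exists (fun x => c%:C * f x); first exact: H12_Z.
  split; first exact: refl.
  apply: aeS2 p2r (robin_vectorZ bOm ipP PhiP c bTh0 Hf) => x E1 E2.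
  exact: etrans (congr1 (fun z => c%:C * z) E1) (esym E2).
split.
  split; last by split; [exact: HHp|exact: HHp|split; exact: refl].
  split; last exact: Fp.
  exists (u j); first exact: (eigenfunction_weak_solution bOm coefs D1u eigu).
  by split; exact: refl.
have E'H r : orth_compl Om ip (calF Om Phi Theta t0) r -> HH Om r by case.
have [B NB B0] := graph_map_small bOm ipP E'H Fp FZ HHp It0 M_C1 M_t0.
have [_ _ cvgTh _] := ThetaC1 _ t0_01.
pose Q t x := (Theta t x - Theta t0 x) / (t - t0) - dTheta t0 x.
pose e t : R := fine (Lnorm (surf Om) +oo (fun x => (Q t x)%:E)).
have [efin e0] : (\forall t \near within I t0^',
      Lnorm (surf Om) +oo (fun x => (Q t x)%:E) \is a fin_num) /\
    e t @[t --> within I t0^'] --> 0.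
  (* The limit in L^oo is taken within [0,1]; it restricts to the smaller I. *)
  apply/fine_cvgP; apply: cvg_trans cvgTh; apply: cvg_app.
  by apply: within_subset; exact: I01.
have [mdTh [C C0 dThC]] := bdTh0.
pose g t : R[i] := omega_hat ip qj (0, M t p).
set L := L2_ip (surf Om) (fun x => (dTheta t0 x)%:C * f x) f.
have gE t : I t -> g t = - L2_ip (surf Om) f
    (fun x => (Theta t x - Theta t0 x)%:C * (f x + (M t p).1 x)).
  move=> It; have [bTh _] := mult _ (I01 _ It).
  have [[MtE _ _] _ _ _] := M_C1 _ It.
  have [Hm1 Hm2] := E'H _ (MtE _ Fp).
  have [k Hk [k1 k2]] : calF Om Phi Theta t (p + M t p).
    by rewrite M_graph//; exists p => //; split; exact: refl.
  rewrite /g /omega_hat /=.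
  (* The first summand drops because M_t acts by zero on the [calK] component; the second enters
     [omega_hat] with a minus sign. *)
  have -> : omega ip p 0 = 0.
    rewrite /omega /HH_ip /J /=.
    by rewrite (ip_0r bOm ipP Hp2) (ip_0r bOm ipP (H12_N bOm Hf)) addr0.
  rewrite sub0r; congr (- _).
  have := omega_robin bOm ipP PhiP bTh0 bTh Hf Hp2 Hm1 Hm2 Hk p2E k1 k2.
  by case: (M t p).
have g0 : g t0 = 0.
  rewrite gE// (_ : (fun x => _) = (fun x => 0 * f x)); last first.
    by apply/funext => x; apply: complex_eq; rewrite !reimE /= subrr; ring.
  rewrite (L2_ip_conj (L2_Z 0 Lf) Lf) (L2_ip_Z1 0 Lf Lf) mul0r.
  by apply: complex_eq; rewrite !reimE /= ?oppr0.
(* The error bound of [multiplier_quotient], with the norm of the first component of M_t p replaced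
   by its majorant B. *)
pose bnd t := L2_norm (surf Om) f *
  (e t * (L2_norm (surf Om) f + B t) + C * B t).
have bnd0 : bnd t @[t --> within I t0^'] --> 0.
  rewrite [X in _ --> X](_ : 0 = L2_norm (surf Om) f *
      (0 * (L2_norm (surf Om) f + 0) + C * 0)); last first.
    by rewrite mul0r mulr0 addr0 mulr0.
  apply: cvgMr; apply: cvgD; last exact: cvgMr.
  by apply: cvgM => //; apply: cvgD => //; exact: cvg_cst.
have quot : \forall t \near within I t0^',
    `|(Re (g t) - Re (g t0)) / (t - t0) - Re (- L)| <= bnd t /\
    `|(Im (g t) - Im (g t0)) / (t - t0) - Im (- L)| <= bnd t.
  have nI : \forall t \near within I t0^', I t /\ t != t0.
    by rewrite near_withinE; apply: filterS (nbhs_dnbhs_neq t0) => t.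
  apply: filterS3 efin NB nI => t tfin tB [It tt0].
  have [[mTh _] _] := mult _ (I01 _ It).
  have [[MtE _ _] _ _ _] := M_C1 _ It.
  have [/H12_L2 Lm _] := E'H _ (MtE _ Fp).
  have et0 : 0 <= e t by apply: fine_ge0; exact: Lnorm_ge0.
  have Qe : {ae (surf Om), forall x, `|Q t x| <= e t}.
    by apply: Lnormoo_ae; rewrite /e fineK.
  have tt00 : t - t0 != 0 by rewrite subr_eq0.
  have [z [zE zr zi]] := multiplier_quotient bTh0.1 mTh mdTh tt00 et0 C0 Qe dThC
    Lf Lm.
  have le_b : L2_norm (surf Om) f * (e t * (L2_norm (surf Om) f +
      L2_norm (surf Om) (M t p).1) + C * L2_norm (surf Om) (M t p).1) <= bnd t.
    apply: ler_wpM2l; first exact: L2_norm_ge0.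
    by apply: lerD; apply: ler_wpM2l => //; exact: lerD.
  rewrite g0 gE// zE; split.
    rewrite (_ : _ - _ = - Re z); last first.
      by rewrite !reimE /=; field.
    by rewrite normrN; exact: le_trans zr le_b.
  rewrite (_ : _ - _ = - Im z); last first.
    by rewrite !reimE /=; field.
  by rewrite normrN; exact: le_trans zi le_b.
(* Both sides are now - L: the left by the assumed derivative formula, the right as the limit of the
   quotients, taken separately in real and imaginary parts. *)
rewrite dlamE -/f -/L /maslov_form /cderiv_within /deriv_within.
apply: complex_eq => /=; apply/esym; apply: cvg_lim => //.
  by apply: cvg_dominated bnd0; apply: filterS quot => t [].
by apply: cvg_dominated bnd0; apply: filterS quot => t [].
Qed.
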